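(* Let $S$ be a finite set, $f:S\to\mathbb{R}$ nonconstant, $M=\max f$, $m=\min f$, $S_M=\{x:f(x)=M\}$, $S_m=\{x:f(x)=m\}$. Let $P$ be an irreducible stochastic matrix on $S$ such that the submatrices of $P$ with rows and columns in $S_M$, respectively in $S_m$, are irreducible, for every $x\in S\setminus S_M$ there is $y\in S_M$ with $P(x,y)>0$, and for every $x\in S\setminus S_m$ there is $y\in S_m$ with $P(x,y)>0$. Then there is a constant $C=C(P,f)$, depending only on $P$ and $f$, such that the following holds. For every $\theta\in\mathbb{R}$, every Markov chain $(X_n)_{n\ge0}$ on $S$ (with arbitrary initial distribution) with transition matrix $P_\theta$, every $n\ge1$ and every $\mu\in[\mu(\theta),M]$, $$\mathbb{P}_\theta\big(f(X_1)+\dots+f(X_n)\ge n\mu\big)\le C^2e^{-n\,D(\mu\,\Vert\,\mu(\theta))}.$$ In particular, if all entries of $P$ are positive then one can take $C=\max_{x,y,z\in S}\frac{P(y,z)}{P(x,z)}$.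
   Context: A nonnegative square matrix $W$ is irreducible if for all indices $x,y$ there is $n\ge1$ with $W^n(x,y)>0$. Exponential family generated by $P$ and $f$: for $\theta\in\mathbb{R}$ let $\tilde P_\theta(x,y)=P(x,y)e^{\theta f(y)}$, $\rho(\theta)$ its spectral radius (a simple eigenvalue), $A(\theta)=\log\rho(\theta)$, and $u_\theta,v_\theta$ the unique positive left and right eigenvectors of $\tilde P_\theta$ for $\rho(\theta)$ with $\sum_xu_\theta(x)=1$, $\sum_xu_\theta(x)v_\theta(x)=1$. Put $P_\theta(x,y)=\frac{\tilde P_\theta(x,y)v_\theta(y)}{\rho(\theta)v_\theta(x)}$, an irreducible stochastic matrix with stationary distribution $\pi_\theta(x)=u_\theta(x)v_\theta(x)$, and $\mu(\theta)=\sum_xf(x)\pi_\theta(x)$. The map $\theta\mapsto\mu(\theta)=\dot A(\theta)$ is a strictly increasing bijection from $\mathbb{R}$ onto $(m,M)$, extended by $\mu(\infty)=M$, $\mu(-\infty)=m$. Limit matrices: $\overline P_\infty(x,y)=P(x,y)1\{y\in S_M\}$, with spectral radius $\rho(\overline P_\infty)>0$ (a simple eigenvalue) and unique left and right eigenvectors $u_\infty,v_\infty$ such that $u_\infty>0$ on $S_M$ and $u_\infty=0$ off $S_M$, $v_\infty>0$, $\sum_xu_\infty(x)=1$, $\sum_xu_\infty(x)v_\infty(x)=1$; $P_\infty(x,y)=\frac{\overline P_\infty(x,y)v_\infty(y)}{\rho(\overline P_\infty)v_\infty(x)}$, with stationary distribution $\pi_\infty=u_\infty v_\infty$. Kullback-Leibler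 divergence rate: for $\theta_1\in\mathbb{R}\cup\{\infty\}$, $\theta_2\in\mathbb{R}$, $D(\theta_1\Vert\theta_2)=\sum_{x,y}\pi_{\theta_1}(x)P_{\theta_1}(x,y)\log\frac{P_{\theta_1}(x,y)}{P_{\theta_2}(x,y)}$ (zero terms when $P_{\theta_1}(x,y)=0$). In terms of means, $D(\mu_1\Vert\mu_2)$ denotes $D(\theta_1\Vert\theta_2)$ where $\mu(\theta_i)=\mu_i$ (so $D(M\Vert\mu_2)=D(\infty\Vert\theta_2)$). *)

(* Defs.v *)
From HB Require Import structures.
From mathcomp Require Import all_boot all_order all_algebra.
From mathcomp Require Import all_classical all_reals all_analysis.
From mathcomp Require Import complex.

Set Implicit Arguments.
Unset Strict Implicit.
Unset Printing Implicit Defensive.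

Import Order.TTheory GRing.Theory Num.Theory.

Local Open Scope classical_set_scope.
Local Open Scope ring_scope.

(* Matrices indexed by a finite type S are functions S -> S -> R; [mx_of]
   re-indexes them by 'I_#|S| to reuse matrix powers and eigenvalues. *)
Section Matrices.
Variables (R : realType) (S : finType).
Implicit Type W : S -> S -> R.

Definition mx_of W : 'M[R]_#|S| :=
  \matrix_(i, j) W (enum_val i) (enum_val j).

Definition irreducible W : Prop :=
  (forall x y, 0 <= W x y) /\
  forall x y, exists n, (1 <= n)%N /\
    0 < (mx_of W ^+ n) (enum_rank x) (enum_rank y).

Definition stochastic W : Prop :=
  (forall x y, 0 <= W x y) /\ (forall x, \sum_y W x y = 1).

Definition submatrix W (A : {set S}) (x y : {x : S | x \in A}) : R :=
  W (val x) (val y).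

(* Largest modulus of a complex eigenvalue. *)
Definition spectral_radius W : R :=
  sup [set ComplexField.Normc.normc z |
       z in [set z : R[i] | eigenvalue (map_mx (real_complex R) (mx_of W)) z]].

Definition left_eigenvector W (r : R) (u : S -> R) : Prop :=
  forall y, \sum_x u x * W x y = r * u y.

Definition right_eigenvector W (r : R) (v : S -> R) : Prop :=
  forall x, \sum_y W x y * v y = r * v x.

End Matrices.

(* S is finite, so for inhabited S these are the maximum and the minimum of f. *)
Definition fmax (R : realType) (S : finType) (f : S -> R) : R := sup (range f).
Definition fmin (R : realType) (S : finType) (f : S -> R) : R := inf (range f).

Definition Smax (R : realType) (S : finType) (f : S -> R) : {set S} :=
  [set x | f x == fmax f]%SET.
Definition Smin (R : realType) (S : finType) (f : S -> R) : {set S} :=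
  [set x | f x == fmin f]%SET.

(* The family is indexed by t : \bar R. The value at +oo is the limit matrix
   carried by the maximizers of f; the value at -oo is its mirror image,
   carried by the minimizers. *)
Section ExponentialFamily.
Variables (R : realType) (S : finType) (P : S -> S -> R) (f : S -> R).

Definition tilted (t : \bar R) (x y : S) : R :=
  match t with
  | r%:E => P x y * expR (r * f y)
  | +oo%E => P x y * (y \in Smax f)%:R
  | -oo%E => P x y * (y \in Smin f)%:R
  end.

Definition rho (t : \bar R) : R := spectral_radius (tilted t).

Definition tilted_support (t : \bar R) : {set S} :=
  match t with
  | _%:E => [set: S]%SET
  | +oo%E => Smax f
  | -oo%E => Smin f
  end.

Definition is_perron_pair (t : \bar R) (uv : (S -> R) * (S -> R)) : Prop :=
  let u := uv.1 in let v := uv.2 in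
  [/\ left_eigenvector (tilted t) (rho t) u
      /\ right_eigenvector (tilted t) (rho t) v,
      (forall x, x \in tilted_support t -> 0 < u x)
      /\ (forall x, x \notin tilted_support t -> u x = 0),
      (forall x, 0 < v x),
      \sum_x u x = 1 & \sum_x u x * v x = 1].

(* The unique such pair (the default value is irrelevant when it exists). *)
Definition perron_pair (t : \bar R) : (S -> R) * (S -> R) :=
  xget (fun=> 0, fun=> 0) [set uv | is_perron_pair t uv].

Definition left_vec (t : \bar R) : S -> R := (perron_pair t).1.
Definition right_vec (t : \bar R) : S -> R := (perron_pair t).2.

Definition exp_family (t : \bar R) (x y : S) : R :=
  tilted t x y * right_vec t y / (rho t * right_vec t x).

Definition stationary (t : \bar R) (x : S) : R := left_vec t x * right_vec t x.

Definition mean (t : \bar R) : R :=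
  match t with
  | r%:E => \sum_x f x * stationary r%:E x
  | +oo%E => fmax f
  | -oo%E => fmin f
  end.

(* Terms with [exp_family t1 x y = 0] vanish through the factor [exp_family t1 x y]. *)
Definition KL (t1 : \bar R) (t2 : R) : R :=
  \sum_x \sum_y stationary t1 x * exp_family t1 x y *
                ln (exp_family t1 x y / exp_family t2%:E x y).

(* Inverse of the bijection [mean] from \bar R onto [fmin f, fmax f]. *)
Definition param (mu : R) : \bar R := xget 0%E [set t | mean t = mu].

(* KL divergence rate in terms of means; mu2 is meant to be in
   ]fmin f, fmax f[, so that its parameter is real. *)
Definition KL_mean (mu1 mu2 : R) : R := KL (param mu1) (fine (param mu2)).

End ExponentialFamily.

(* The Markov property, P(X_{n+1} = s_{n+1} | X_0 = s_0, ..., X_n = s_n)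
   = Q(s_n, s_{n+1}), is multiplied out by the probability of the conditioning
   event; it is then trivial when that event is null. The initial distribution
   is unconstrained. *)
Definition markov_chain (R : realType) (S : finType) (d : measure_display)
    (Omega : measurableType d) (Pr : probability Omega R)
    (X : nat -> Omega -> S) (Q : S -> S -> R) : Prop :=
  (forall n x, measurable (X n @^-1` [set x])) /\
  forall n (s : nat -> S),
    Pr [set w | forall i, (i <= n.+1)%N -> X i w = s i] =
    (Pr [set w | forall i, (i <= n)%N -> X i w = s i] * (Q (s n) (s n.+1))%:E)%E.

Definition chernoff_bound (R : realType) (S : finType) (P : S -> S -> R)
    (f : S -> R) (C : R) : Prop :=
  forall (theta : R) (d : measure_display) (Omega : measurableType d)
    (Pr : probability Omega R) (X : nat -> Omega -> S) (n : nat) (mu : R),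
    markov_chain Pr X (exp_family P f theta%:E) ->
    (1 <= n)%N ->
    mean P f theta%:E <= mu <= fmax f ->
    (Pr [set w | (n%:R * mu <= \sum_(1 <= i < n.+1) f (X i w))%R] <=
     (C ^+ 2 * expR (- (n%:R * KL_mean P f mu (mean P f theta%:E))))%R%:E)%E.

(* Used for entrywise positive P, where the ratios are positive, so the
   default value 0 of the iterated maximum plays no role. *)
Definition max_ratio (R : realType) (S : finType) (P : S -> S -> R) : R :=
  \big[Num.max/0]_(x : S) \big[Num.max/0]_(y : S) \big[Num.max/0]_(z : S)
    (P y z / P x z).

(* Main.v *)
Require Import Defs.
From mathcomp Require Import all_boot all_order all_algebra.
From mathcomp Require Import all_classical all_reals all_analysis.
From mathcomp Require Import complex ring lra.

(**
Fix a real parameter theta and let mu be a level between mean theta and the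
maximum of f. Let t be the parameter with mean mu: a real number when mu is
below the maximum (mean_surjective), and +oo when mu is the maximum. The two
kernels of the family differ by a tilt and a coboundary,

  P_t(x, y) = P_theta(x, y) * phi(y) * g(y) / (lambda * g(x)),

where g is the quotient of the right Perron eigenvectors, and phi(y) is
exp((t - theta) * (f(y) - mu)) for real t and the indicator of the maximizers
of f for t = +oo. Three consequences of this identity give the theorem.

First, the rows of P_t sum to one, so g is an eigenvector of P_theta * phi for
lambda. Hence phi(X_1) ... phi(X_k) g(X_k) / lambda^k is a martingale, and it
gives Pr(E) <= (max g / min g) * lambda^n for every event E on which
phi(X_1) ... phi(X_n) >= 1 (markov_chain_exponential_bound). The event that
the sum of f is at least n * mu is such an event.

Second, in the divergence rate of P_t from P_theta the logarithm of the
coboundary g(y) / g(x) has mean zero under the stationary law, and so has the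
logarithm of phi, because mean t = mu. What is left is -ln lambda
(divergence_tilt), so that lambda^n = exp(-n D).

Third, max g / min g is at most C^2 as soon as right_vec t x <= C *
right_vec t y for all states x, y and all parameters t, +oo included. If P is
positive, this holds for C = max_ratio P by comparing two rows of the
eigenvector equation (right_vec_ratio_positive). In general, paths of the
positivity graph give such a C when the parameter is bounded; when it is
large, the tilted matrix, once normalized, is dominated by its columns in the
maximizers of f, which are irreducible among themselves and reached from every
state in one step (dominant_core_ratio); very negative parameters are symmetric
(right_vec_ratio_uniform).

The family itself is built from scratch. Existence of the Perron pairs comes
from the Collatz-Wielandt extremal problem (perron_frobenius). The definitions
of perron_pair and param choose a witness; for the pairs, existence is enough,
while for param one needs that mean is injective. That mean is strictly
increasing follows from the identity

  D(r || s) + D(s || r) = (r - s) * (mean r - mean s)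

and from the strict positivity of the divergence: if two kernels of the family
coincided, the maximizers and the minimizers of f would force the same growth
rate. The same identity gives continuity, since the left-hand side is
quadratic in r - s by a perturbation estimate for g (tilt_density_bounds).
*)

Set Implicit Arguments.
Unset Strict Implicit.
Unset Printing Implicit Defensive.

Import Order.TTheory GRing.Theory Num.Theory.
Import numFieldNormedType.Exports.

Local Open Scope ring_scope.

(** * Positivity graphs and irreducibility *)

Lemma sum_gt0_exists (R : realType) (I : finType) (F : I -> R) :
  0 < \sum_i F i -> exists i, 0 < F i.
Proof.
move=> F_gt0; apply: contrapT => F_le0; move: F_gt0; rewrite ltNge => /negP[].
by apply: sumr_le0 => i _; rewrite leNgt; apply/negP => ?; apply: F_le0; exists i.
Qed.

Lemma positive_lower_bound (R : realType) (I : finType) (F : I -> R) :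
  (forall i, 0 < F i) -> exists e : R, 0 < e /\ forall i, e <= F i.
Proof.
move=> F_gt0; exists (\big[Num.min/1]_i F i); split.
  by apply: lt_bigmin.
by move=> i; exact: bigmin_le.
Qed.

Section Reachability.
Variables (R : realType) (T : finType).
Implicit Type W : T -> T -> R.

Definition positive_edge W : rel T := fun x y => 0 < W x y.

Lemma connect_pred_closed (e : rel T) (D : T -> Prop) (x y : T) :
  (forall a b, e a b -> D b -> D a) -> connect e x y -> D y -> D x.
Proof.
move=> De /connectP[p]; elim: p x => [|z p IHp] x /=; first by move=> _ ->.
by case/andP=> exz epz yE Dy; exact: De exz (IHp _ epz yE Dy).
Qed.

Lemma mx_of_pow_step W (n : nat) (x y : T) :
  (forall a b, 0 <= W a b) ->
  0 < (mx_of W ^+ n.+1) (enum_rank x) (enum_rank y) ->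
  exists z, 0 < W x z /\ 0 < (mx_of W ^+ n) (enum_rank z) (enum_rank y).
Proof.
move=> W0; rewrite exprS mxE => /sum_gt0_exists[j].
rewrite mxE enum_rankK => W_gt0; exists (enum_val j); rewrite enum_valK.
have Wj := W0 x (enum_val j); have [Wj0|Wj0] := eqVneq (W x (enum_val j)) 0.
  by move: W_gt0; rewrite Wj0 mul0r ltxx.
have {}Wj : 0 < W x (enum_val j) by rewrite lt_def Wj0 Wj.
by split=> //; move: W_gt0; rewrite pmulr_rgt0.
Qed.

Lemma mx_of_pow_connect W (n : nat) (x y : T) :
  (forall a b, 0 <= W a b) ->
  0 < (mx_of W ^+ n) (enum_rank x) (enum_rank y) -> connect (positive_edge W) x y.
Proof.
move=> W0; elim: n x => [|n IHn] x.
  rewrite expr0 mxE; case: eqP => [/enum_rank_inj -> _|_]; first exact: connect0.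
  by rewrite ltxx.
move=> /(mx_of_pow_step W0)[z [Wxz /IHn]]; apply: connect_trans.
exact: connect1.
Qed.

Lemma irreducible_connect W (x y : T) :
  irreducible W -> connect (positive_edge W) x y.
Proof. by case=> W0 /(_ x y)[n [_ ]]; exact: mx_of_pow_connect. Qed.

Lemma irreducible_edge W (x : T) : irreducible W -> exists y, 0 < W x y.
Proof.
case=> W0 /(_ x x)[[|n] [//]] _ /(mx_of_pow_step W0)[z [Wxz _]].
by exists z.
Qed.

End Reachability.

Section SubmatrixReachability.
Variables (R : realType) (S : finType) (W : S -> S -> R) (K : {set S}).
Hypothesis K_irreducible : irreducible (@submatrix R S W K).

(** The hypothesis speaks of a matrix on the subtype of K; in S it says that
    the states of K communicate through K. *)
Lemma submatrix_connect (x y : S) : x \in K -> y \in K ->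
  connect (fun a b => (0 < W a b) && (b \in K)) x y.
Proof.
move=> xK yK; pose D (a : {x | x \in K}) :=
  connect (fun a b => (0 < W a b) && (b \in K)) (val a) y.
suff : D (exist _ x xK) by [].
have xy := irreducible_connect (exist _ x xK) (exist _ y yK) K_irreducible.
apply: (connect_pred_closed (D := D) _ xy); last exact: connect0.
move=> [a aK] [b bK]; rewrite /positive_edge /submatrix /D /= => Wab.
by apply: connect_trans; apply: connect1; rewrite Wab.
Qed.

Lemma submatrix_edge (x : S) : x \in K -> exists y, 0 < W x y /\ y \in K.
Proof.
move=> xK; have [[y yK] /= Wxy] := irreducible_edge (exist _ x xK) K_irreducible.
by exists y.
Qed.

Hypothesis K_reachable : forall x, x \notin K -> exists y, y \in K /\ 0 < W x y.

Lemma core_edge (x : S) : exists y, 0 < W x y /\ y \in K.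
Proof.
have [/submatrix_edge //|/K_reachable[y [yK Wxy]]] := boolP (x \in K).
by exists y.
Qed.

Lemma core_connect (x y : S) : y \in K ->
  connect (fun a b => (0 < W a b) && (b \in K)) x y.
Proof.
move=> yK; have [z [Wxz zK]] := core_edge x.
apply: connect_trans (submatrix_connect zK yK).
by apply: connect1; rewrite Wxz.
Qed.

End SubmatrixReachability.

(** * Perron-Frobenius theory for a recurrent core *)

Section PerronFrobenius.
Variables (R : realType) (S : finType) (W : S -> S -> R).
Implicit Types (u v z : S -> R) (r : R).

Definition act v (x : S) : R := \sum_y W x y * v y.

Import ArrowAsProduct.
Local Open Scope classical_set_scope.

Hypothesis W_ge0 : forall x y, 0 <= W x y.

(** The Collatz-Wielandt problem has a solution by compactness of the set of
    pairs (r, v) with v in the simplex and r * v <= W v. Such a pair is encoded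
    as one function on [option S], with r at [None], so that compactness comes
    from the product topology. *)
Lemma extremal_subinvariant (x0 : S) : exists r v,
  [/\ 0 <= r, forall x, 0 <= v x, \sum_x v x = 1,
      forall x, r * v x <= act v x &
      forall r' v', 0 <= r' -> (forall x, 0 <= v' x) -> \sum_x v' x = 1 ->
        (forall x, r' * v' x <= act v' x) -> r' <= r].
Proof.
pose B : R := \sum_x \sum_y W x y.
pose T := prod_topology (fun _ : option S => R : topologicalType).
pose range (i : option S) : set R := if i is Some _ then `[0, 1] else `[0, B].
pose box : set T := [set a | forall i, range i (a i)].
have box_compact : compact box.
  apply: (@tychonoff _ (fun=> R : topologicalType) range) => -[x|];
  exact: segment_compact.
have proj_cont i : continuous (fun a : T => a i : R).
  exact: (@proj_continuous _ (fun _ : option S => R : topologicalType) i).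
pose simplex : set T := [set a | \sum_x a (Some x) = 1].
pose subinv x : set T :=
  [set a | 0 <= act (fun y => a (Some y)) x - a None * a (Some x)].
have sum_cont (F : S -> T -> R) :
    (forall x, continuous (F x)) -> continuous (fun a => \sum_x F x a).
  by move=> Fc; apply: continuous_big => //; exact: add_continuous.
have simplex_closed : closed simplex.
  apply: (@preimage_closed _ _ (fun a : T => \sum_x a (Some x)) [set 1]).
    by move=> a _; exact: (sum_cont (fun x a => a (Some x)) (fun x => proj_cont _)).
  exact: closed_eq.
have act_cont x : continuous (fun a : T => act (fun y => a (Some y)) x).
  apply: (sum_cont (fun y a => W x y * a (Some y))) => y b.
  exact: (@cvgM _ T (nbhs b) _ (fun=> W x y) (fun a => a (Some y)) _ _
    (cvg_cst _) (proj_cont _ _)).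
have prod_cont x : continuous (fun a : T => a None * a (Some x)).
  move=> b; exact: (@cvgM _ T (nbhs b) _ (fun a => a None) (fun a => a (Some x))
    _ _ (proj_cont _ _) (proj_cont _ _)).
have subinv_closed x : closed (subinv x).
  apply: (@preimage_closed _ _ (fun a : T =>
    act (fun y => a (Some y)) x - a None * a (Some x)) [set t | 0 <= t]).
    move=> b _; exact: (@cvgB _ _ T (nbhs b) _ (fun a => act (fun y => a (Some y)) x)
      (fun a => a None * a (Some x)) _ _ (act_cont x b) (prod_cont x b)).
  exact: closed_ge.
pose A := box `&` (simplex `&` \bigcap_(x in setT) subinv x).
have A_compact : compact A.
  apply: compact_closedI => //; apply: closedI => //.
  exact: closed_bigI.
have B_ge0 : 0 <= B by apply: sumr_ge0 => x _; exact: sumr_ge0.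
have in_A r v : 0 <= r -> (forall x, 0 <= v x) -> \sum_x v x = 1 ->
    (forall x, r * v x <= act v x) ->
    A (fun i => if i is Some x then v x else r).
  move=> r_ge0 v_ge0 v_sum rv.
  have v_le1 x : v x <= 1.
    by rewrite -v_sum (bigD1 x) //= lerDl; apply: sumr_ge0.
  split; last by split => // x _; rewrite /subinv /= subr_ge0.
  case=> [x|] /=; rewrite in_itv /= ?v_ge0 ?v_le1 // r_ge0 /=.
  rewrite -[r]mulr1 -v_sum mulr_sumr; apply: ler_sum => x _.
  apply: le_trans (rv x) _; apply: ler_sum => y _.
  by rewrite -[leRHS]mulr1; exact: ler_wpM2l.
have A_nonempty : A !=set0.
  (* r = 0 and a point mass *)
  exists (fun i => if i is Some x then (x == x0)%:R else 0).
  apply: in_A => //; first by rewrite (bigD1 x0) //= eqxx big1 ?addr0 // => x /negPf->.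
  by move=> x; rewrite mul0r; apply: sumr_ge0 => y _; rewrite mulr_ge0.
have [a + a_max] : exists2 a, a \in A & forall b, b \in A -> b None <= a None.
  apply: (@compact_EVT_max T R (fun a => a None)) => //.
  by apply: continuous_subspaceT => b; exact: proj_cont.
rewrite inE => -[a_box [a_sum a_sub]].
exists (a None), (fun x => a (Some x)); split => //.
- by have := a_box None; rewrite /= in_itv => /andP[].
- by move=> x; have := a_box (Some x); rewrite /= in_itv => /andP[].
- by move=> x; have := a_sub x I; rewrite /subinv /= subr_ge0.
- move=> r' v' r'0 v'0 v'1 rv'.
  by have := a_max _ (mem_set (in_A r' v' r'0 v'0 v'1 rv')).
Qed.

(** The action of I + W. Its powers can only enlarge the support of a
    nonnegative vector, hence no assumption of aperiodicity will be needed. *)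
Definition lazy_act v x := v x + act v x.

Lemma act_ge0 v x : (forall y, 0 <= v y) -> 0 <= act v x.
Proof. by move=> v0; apply: sumr_ge0 => y _; rewrite mulr_ge0. Qed.

Lemma act_ge_term v x y : (forall y, 0 <= v y) -> W x y * v y <= act v x.
Proof.
move=> v0; rewrite /act (bigD1 y) //= lerDl; apply: sumr_ge0 => z _.
by rewrite mulr_ge0.
Qed.

Lemma iter_lazy_act_ge0 n v x :
  (forall y, 0 <= v y) -> 0 <= iter n lazy_act v x.
Proof.
by move=> v0; elim: n x => //= n IHn x; rewrite addr_ge0 // act_ge0.
Qed.

Lemma iter_lazy_act_pos z y : (forall x, 0 <= z x) -> 0 < z y ->
  (forall x, connect (positive_edge W) x y) ->
  exists n, forall x, 0 < iter n lazy_act z x.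
Proof.
move=> z_ge0 z_gt0 to_y.
have it0 n x : 0 <= iter n lazy_act z x by exact: iter_lazy_act_ge0.
have /boolp.choice[n n_gt0] x : exists n, 0 < iter n lazy_act z x.
  pose D x := exists n, 0 < iter n lazy_act z x.
  apply: (connect_pred_closed (D := D) _ (to_y x)); last by exists 0%N.
  move=> a b Wab [n b_gt0]; exists n.+1; rewrite iterS.
  apply: ltr_wpDl => //; apply: lt_le_trans (act_ge_term a b _) => //.
  exact: mulr_gt0.
exists (\max_x n x)%N => x.
have /subnKC <- := leq_bigmax x (F := n).
rewrite addnC; elim: (_ - _)%N => [|k IHk]; first exact: n_gt0.
by rewrite addSn iterS; apply: ltr_pwDl => //; apply: act_ge0.
Qed.

(** I + W commutes with W - r. *)
Lemma iter_lazy_act_defect n r v x :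
  iter n lazy_act (fun x => act v x - r * v x) x =
  act (iter n lazy_act v) x - r * iter n lazy_act v x.
Proof.
elim: n x => //= n IHn x; rewrite /lazy_act IHn.
set w := iter n lazy_act v.
have -> : act (iter n lazy_act (fun x => act v x - r * v x)) x =
    act (act w) x - r * act w x.
  rewrite /act mulr_sumr -sumrB; apply: eq_bigr => y _.
  by rewrite IHn -/w -/(act w y); ring.
have -> : act (fun y => w y + act w y) x = act w x + act (act w) x.
  by rewrite /act -big_split; apply: eq_bigr => y _; rewrite mulrDr.
by ring.
Qed.

Variables (K : {set S}).
Hypothesis W_off_K : forall x y, y \notin K -> W x y = 0.
Hypothesis K_reachable : forall x y, y \in K -> connect (positive_edge W) x y.
Hypothesis W_edge : forall x, exists y, 0 < W x y.

(** Let (r, v) be extremal, and z = W v - r v >= 0. If z were nonzero at a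
    state of K, some power of I + W would turn z into a positive vector, and v
    into a vector for which r can be increased. So z vanishes on K, which
    means W z = 0: then W v is an eigenvector, and its positivity propagates
    backwards from K. A state of K with v > 0 exists because r > 0. *)
Lemma positive_right_eigenvector (x0 : S) :
  exists r v, [/\ 0 < r, forall x, 0 < v x & right_eigenvector W r v].
Proof.
have [r [v [r_ge0 v_ge0 v_sum rv_le r_max]]] := extremal_subinvariant x0.
have cardS : 0 < #|S|%:R :> R by rewrite ltr0n; apply/card_gt0P; exists x0.
have r_gt0 : 0 < r.
  have row_gt0 x : 0 < act (fun=> 1) x.
    have [y Wxy] := W_edge x; apply: lt_le_trans (act_ge_term x y _) => //.
    by rewrite mulr1.
  have [e [e_gt0 e_le]] := positive_lower_bound row_gt0.
  apply: (lt_le_trans e_gt0); apply: (r_max _ (fun=> #|S|%:R^-1)) => //.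
  - exact: ltW.
  - by rewrite sumr_const -[_ *+ _]mulr_natl mulfV // gt_eqF.
  - move=> x; rewrite /act -mulr_suml ler_wpM2r ?invr_ge0 ?(ltW cardS) //.
    by apply: le_trans (e_le x) _; apply: ler_sum => y _; rewrite mulr1.
pose z x := act v x - r * v x.
have z_ge0 x : 0 <= z x by rewrite subr_ge0.
have z_K y : y \in K -> z y = 0.
  move=> yK; apply: contrapT => /eqP z_neq0.
  have z_gt0 : 0 < z y by rewrite lt_def z_neq0 z_ge0.
  have [n] := iter_lazy_act_pos z_ge0 z_gt0 (fun x => K_reachable x yK).
  set w := iter n lazy_act v => defect_gt0.
  have {}defect_gt0 x : 0 < act w x - r * w x.
    by rewrite -iter_lazy_act_defect.
  have w_ge0 x : 0 <= w x by exact: iter_lazy_act_ge0.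
  have w_le x : w x <= \sum_x w x.
    by rewrite (bigD1 x) //= lerDl; apply: sumr_ge0.
  have w_sum : 0 < \sum_x w x.
    have := defect_gt0 x0; rewrite subr_gt0 => aw_gt.
    have /sum_gt0_exists[x Ww] : 0 < act w x0.
      by apply: le_lt_trans aw_gt; rewrite mulr_ge0.
    apply: lt_le_trans (w_le x); rewrite lt_def w_ge0 andbT.
    by apply: contraTneq Ww => ->; rewrite mulr0 ltxx.
  have [e [e_gt0 e_le]] := positive_lower_bound defect_gt0.
  suff : r + e / \sum_x w x <= r.
    by rewrite gerDl leNgt divr_gt0.
  apply: (r_max _ (fun x => w x / \sum_x w x)).
  - by rewrite addr_ge0 // divr_ge0 // ltW.
  - by move=> x; rewrite divr_ge0 // ltW.
  - by rewrite -mulr_suml mulfV // gt_eqF.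
  - move=> x; have -> : act (fun x => w x / \sum_x w x) x = act w x / \sum_x w x.
      by rewrite /act mulr_suml; apply: eq_bigr => y' _; rewrite mulrA.
    rewrite mulrA ler_wpM2r ?invr_ge0 ?(ltW w_sum) // mulrDl -lerBrDl.
    apply: le_trans (e_le x); rewrite -mulrA ler_piMr ?(ltW e_gt0) //.
    by rewrite mulrC ler_pdivrMr // mul1r.
have act_v_eigen x : act (act v) x = r * act v x.
  rewrite {1 3}/act mulr_sumr; apply: eq_bigr => y _.
  have [yK|/W_off_K->] := boolP (y \in K); last by rewrite !mul0r mulr0.
  by have /eqP := z_K y yK; rewrite subr_eq0 => /eqP->; ring.
(* A state y of K with v y > 0. *)
have [x1 v_x1] : exists x, 0 < v x by apply: sum_gt0_exists; rewrite v_sum.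
have [y] : exists y, 0 < W x1 y * v y.
  by apply: sum_gt0_exists; apply: lt_le_trans (rv_le x1); exact: mulr_gt0.
have [yK Wvy|/W_off_K->] := boolP (y \in K); last by rewrite mul0r ltxx.
have v_y : 0 < v y.
  by rewrite lt_def v_ge0 andbT; apply: contraTneq Wvy => ->; rewrite mulr0 ltxx.
exists r, (act v); split=> // x.
apply: (connect_pred_closed (D := fun x => 0 < act v x) _ (K_reachable x yK)).
  move=> a b Wab b_gt0; rewrite -(pmulr_rgt0 _ r_gt0) -act_v_eigen.
  apply: lt_le_trans (act_ge_term a b _); first exact: mulr_gt0.
  by move=> c; exact: act_ge0.
by apply: lt_le_trans (rv_le y); exact: mulr_gt0.
Qed.

Lemma eigenvalue_singular r v (x0 : S) :
  (forall x, 0 < v x) -> right_eigenvector W r v ->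
  \det (mx_of W - r%:M) = 0.
Proof.
move=> v_gt0 Wv; rewrite -det_tr; apply/eqP/det0P.
exists (\row_i v (enum_val i)).
  apply/eqP => /rowP/(_ (enum_rank x0)); rewrite !mxE enum_rankK => v0.
  by have := v_gt0 x0; rewrite v0 ltxx.
apply/rowP => j; rewrite !mxE.
under eq_bigr do rewrite !mxE mulrBr.
rewrite sumrB; apply/eqP; rewrite subr_eq0; apply/eqP.
transitivity (\sum_y W (enum_val j) y * v y).
  rewrite [RHS](reindex (@enum_val S predT)); last exact: onW_bij (enum_val_bij _).
  by apply: eq_bigr => i _; rewrite mulrC.
rewrite Wv (bigD1 j) //= eqxx mulr1n big1 ?addr0 1?mulrC // => i.
by rewrite eq_sym => /negPf->; rewrite mulr0n mulr0.
Qed.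

(** By the triangle inequality the absolute values are subinvariant; pairing
    the nonnegative defect with the positive right eigenvector gives zero. *)
Lemma abs_left_eigenvector r v (w : 'rV[R]_#|S|) :
  0 < r -> (forall x, 0 < v x) -> right_eigenvector W r v ->
  w *m mx_of W = r *: w ->
  left_eigenvector W r (fun x => `|w 0 (enum_rank x)|).
Proof.
move=> r_gt0 v_gt0 Wv wW; set u := fun x => _.
have wWE y : \sum_x w 0 (enum_rank x) * W x y = r * w 0 (enum_rank y).
  move/rowP: wW => /(_ (enum_rank y)); rewrite !mxE => <-.
  rewrite (reindex (@enum_val S predT)); last exact: onW_bij (enum_val_bij _).
  by apply: eq_bigr => i _; rewrite !mxE enum_valK enum_rankK.
have u_sub y : 0 <= \sum_x u x * W x y - r * u y.
  rewrite subr_ge0 -[r]gtr0_norm // -normrM -wWE.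
  apply: le_trans (ler_norm_sum _ _ _) _; apply: ler_sum => x _.
  by rewrite normrM (ger0_norm (W_ge0 _ _)).
have sum0 : \sum_y (\sum_x u x * W x y - r * u y) * v y = 0.
  under eq_bigr do rewrite mulrBl mulr_suml.
  rewrite sumrB exchange_big /=; apply/eqP; rewrite subr_eq0; apply/eqP.
  apply: eq_bigr => x _; rewrite -mulrA mulrCA -Wv mulr_sumr.
  by apply: eq_bigr => y _; rewrite mulrA.
move=> y; apply/eqP; rewrite -subr_eq0; apply/eqP.
have terms0 := psumr_eq0P (fun y _ => mulr_ge0 (u_sub y) (ltW (v_gt0 y))) sum0.
move/eqP: (terms0 y isT); by rewrite mulf_eq0 (gt_eqF (v_gt0 y)) orbF => /eqP.
Qed.

Lemma normc_real_complex (r : R) : ComplexField.Normc.normc (real_complex R r) = `|r|.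
Proof. by rewrite /= expr0n addr0 sqrtr_sqr. Qed.


(** The moduli of a complex left eigenvector for z are subinvariant for
    |z|, and pairing them with v shows that |z| is at most r. *)
Lemma spectral_radius_eigenvalue r u v (x0 : S) :
  0 < r -> (forall x, 0 < v x) -> right_eigenvector W r v ->
  (exists x, u x != 0) -> left_eigenvector W r u ->
  spectral_radius W = r.
Proof.
move=> r_gt0 v_gt0 Wv [x u_x] uW.
rewrite /spectral_radius; set E := (X in sup X).
have rE : E r.
  exists (real_complex R r); last by rewrite normc_real_complex gtr0_norm.
  apply/eigenvalueP; exists (\row_i real_complex R (u (enum_val i))).
    apply/rowP => j; rewrite !mxE.
    rewrite -rmorphM -uW rmorph_sum /=.
    rewrite [RHS](reindex (@enum_val S predT)); last exact: onW_bij (enum_val_bij _).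
    by apply: eq_bigr => i _; rewrite !mxE -rmorphM.
  apply/eqP => /rowP/(_ (enum_rank x)); rewrite !mxE enum_rankK => /eqP.
  by rewrite fmorph_eq0; apply/negP.
have E_le t : E t -> t <= r.
  move=> [z /eigenvalueP[w wW w_neq0] <-].
  pose n x := ComplexField.Normc.normc (w 0 (enum_rank x)).
  have n_ge0 y : 0 <= n y by rewrite /n; case: (w _ _) => *; exact: sqrtr_ge0.
  have n_sub y : ComplexField.Normc.normc z * n y <= \sum_x n x * W x y.
    rewrite -ComplexField.Normc.normcM.
    move/rowP: wW => /(_ (enum_rank y)); rewrite !mxE => <-.
    rewrite [leRHS](reindex (@enum_val S predT)); last exact: onW_bij (enum_val_bij _).
    rewrite /=; elim/big_ind2: _ => [||i _].
    - by rewrite ComplexField.Normc.normc0.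
    - by move=> a b c d ab cd; apply: le_trans (le_normcD _ _) _; exact: lerD.
    - rewrite ComplexField.Normc.normcM !mxE normc_real_complex ger0_norm //.
      by rewrite /n enum_valK enum_rankK.
  have nv_gt0 : 0 < \sum_x n x * v x.
    have [i w_i] : exists i, w 0 i != 0.
      apply: contrapT => w0; move/eqP: w_neq0; apply; apply/rowP => i; rewrite mxE.
      by apply: contrapT => /eqP w_i; apply: w0; exists i.
    rewrite (bigD1 (enum_val i)) //= ltr_pwDl //.
      rewrite mulr_gt0 // lt_def n_ge0 andbT /n enum_valK.
      by apply: contraNneq w_i => /ComplexField.Normc.eq0_normc->.
    by apply: sumr_ge0 => y _; rewrite mulr_ge0 // ltW.
  rewrite -(ler_pM2r nv_gt0) !mulr_sumr.
  have -> : \sum_x r * (n x * v x) = \sum_y (\sum_x n x * W x y) * v y.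
    under [RHS]eq_bigr do rewrite mulr_suml.
    rewrite exchange_big; apply: eq_bigr => a _ /=.
    rewrite mulrCA -Wv mulr_sumr; apply: eq_bigr => b _; exact: mulrA.
  by apply: ler_sum => y _; rewrite mulrA ler_wpM2r // ltW.
apply/eqP; rewrite eq_le; apply/andP; split.
  by apply: ge_sup; [exists r | move=> t /E_le].
by apply: ub_le_sup => //; exists r => t /E_le.
Qed.

(** All the mass of W sits in the columns of a set K that is accessible from
    every state. Taking K to be the whole space gives the irreducible case,
    and taking it to be the set of maximizers of f gives the limit matrix, for
    which left eigenvectors are supported by K. The left eigenvector is
    obtained from the singularity of W - r. *)
Lemma perron_frobenius (x0 : S) :
  0 < spectral_radius W /\
  exists u v, [/\ left_eigenvector W (spectral_radius W) u
      /\ right_eigenvector W (spectral_radius W) v,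
      (forall x, x \in K -> 0 < u x)
      /\ (forall x, x \notin K -> u x = 0),
      (forall x, 0 < v x),
      \sum_x u x = 1 & \sum_x u x * v x = 1].
Proof.
have [r [v [r_gt0 v_gt0 Wv]]] := positive_right_eigenvector x0.
have /eqP/det0P[w w_neq0] := eigenvalue_singular x0 v_gt0 Wv.
rewrite mulmxBr mul_mx_scalar => /eqP; rewrite subr_eq0 => /eqP wW.
have := abs_left_eigenvector r_gt0 v_gt0 Wv wW.
set u := fun x => _ => uW.
have u_ge0 x : 0 <= u x by exact: normr_ge0.
have u_off x : x \notin K -> u x = 0.
  move=> xK; apply: (mulfI (lt0r_neq0 r_gt0)); rewrite mulr0 -uW.
  by apply: big1 => y _; rewrite W_off_K ?mulr0.
have [i w_i] : exists i, w 0 i != 0.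
  apply: contrapT => w0; move/eqP: w_neq0; apply; apply/rowP => i; rewrite mxE.
  by apply: contrapT => /eqP w_i; apply: w0; exists i.
have u_i : 0 < u (enum_val i) by rewrite /u enum_valK normr_gt0.
have u_on x : x \in K -> 0 < u x.
  move=> xK; move: u_i.
  apply: (connect_pred_closed (D := fun a => 0 < u a -> 0 < u x) _
    (K_reachable _ xK)) => // a b Wab b_x u_a; apply: b_x.
  rewrite -(pmulr_rgt0 _ r_gt0) -uW (bigD1 a) //=; apply: ltr_pwDl.
    exact: mulr_gt0.
  by apply: sumr_ge0 => c _; rewrite mulr_ge0.
have sr : spectral_radius W = r.
  apply: (spectral_radius_eigenvalue x0 r_gt0 v_gt0 Wv _ uW).
  by exists (enum_val i); rewrite gt_eqF.
have u_sum : 0 < \sum_x u x.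
  by rewrite (bigD1 (enum_val i)) //=; apply: ltr_pwDl => //; apply: sumr_ge0.
have uv_sum : 0 < \sum_x u x * v x.
  rewrite (bigD1 (enum_val i)) //=; apply: ltr_pwDl; first exact: mulr_gt0.
  by apply: sumr_ge0 => y _; rewrite mulr_ge0 // ltW.
rewrite sr; split=> //.
set a := \sum_x u x in u_sum; set b := \sum_x u x * v x in uv_sum.
exists (fun x => u x / a), (fun x => v x * (a / b)).
split.
- split=> x.
    under eq_bigr do rewrite mulrAC.
    by rewrite -mulr_suml uW mulrA.
  under eq_bigr do rewrite mulrA.
  by rewrite -mulr_suml Wv mulrA.
- split=> x xK; first by rewrite divr_gt0 // u_on.
  by rewrite u_off // mul0r.
- by move=> x; rewrite mulr_gt0 // divr_gt0.
- by rewrite -mulr_suml mulfV // gt_eqF.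
- transitivity (\sum_x u x * v x / b).
    by apply: eq_bigr => x _; field; rewrite !gt_eqF.
  by rewrite -mulr_suml mulfV // gt_eqF.
Qed.

End PerronFrobenius.

(** * An exponential inequality for Markov chains *)

Section MarkovChainBound.
Variables (R : realType) (S : finType) (d : measure_display).
Variables (Omega : measurableType d) (Pr : probability Omega R).
Variables (X : nat -> Omega -> S) (Q : S -> S -> R).
Hypothesis X_markov : markov_chain Pr X Q.
Local Open Scope classical_set_scope.

Lemma probability_cover_le (B : set Omega) (A : S -> set Omega) :
  measurable B -> (forall x, measurable (A x)) ->
  (forall w, B w -> exists x, A x w) ->
  fine (Pr B) <= \sum_x fine (Pr (A x)).
Proof.
move=> mB mA cover.
apply: (@le_trans _ _ (fine (Pr (\big[setU/set0]_x A x)))).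
  have mU : measurable (\big[setU/set0]_x A x) by exact: bigsetU_measurable.
  apply: fine_le; rewrite ?fin_num_measure //; apply: le_measure; rewrite ?inE //.
  move=> w /cover[x Axw]; rewrite -bigcup_seq; exists x => //=.
  exact: mem_index_enum.
elim: (index_enum S) => [|x r IHr].
  by rewrite !big_nil measure0.
have mr : measurable (\big[setU/set0]_(y <- r) A y) by exact: bigsetU_measurable.
rewrite !big_cons; apply: le_trans (lerD (lexx _) IHr).
rewrite -lee_fin EFinD !fineK ?fin_num_measure //; last exact: measurableU.
exact: measureU2.
Qed.

Definition prefix_event (s : nat -> S) (k : nat) : set Omega :=
  [set w | forall i, (i <= k)%N -> X i w = s i].

Lemma prefix_event_measurable s k : measurable (prefix_event s k).
Proof.
rewrite (_ : prefix_event s k = \bigcap_(i < k.+1) (X i @^-1` [set s i])).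
  apply: bigcap_measurable; first by exists 0%N.
  by move=> i _; exact: X_markov.1.
by apply/seteqP; split => w sw i ik; exact: sw.
Qed.

Lemma measurable_sum_event (f : S -> R) (n : nat) (c : R) :
  measurable [set w | c <= \sum_(1 <= i < n.+1) f (X i w)].
Proof.
have mfX i : measurable_fun setT (fun w => f (X i w)).
  move=> _ Y _; rewrite setTI.
  have -> : (fun w => f (X i w)) @^-1` Y =
      \bigcup_(x in [set x | Y (f x)]) (X i @^-1` [set x]).
    by apply/seteqP; split=> w /=; [exists (X i w) | move=> [x Yfx ->]].
  by apply: fin_bigcup_measurable => [|x _]; [exact: finite_finset | exact: X_markov.1].
have := @measurable_sum _ _ R setT _ (index_iota 1 n.+1) (fun i w => f (X i w)) mfX.
have mI : measurable (`[c, +oo[ : set R) by exact: measurable_itv.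
move=> /(_ measurableT _ mI); rewrite setTI.
by congr measurable; apply/seteqP; split=> w /=; rewrite in_itv /= andbT.
Qed.

Variables (phi g : S -> R) (lambda : R) (n : nat) (E : set Omega).
Hypothesis phi_ge0 : forall x, 0 <= phi x.
Hypothesis g_gt0 : forall x, 0 < g x.
Hypothesis Q_ge0 : forall x y, 0 <= Q x y.
Hypothesis g_eigen : forall x, \sum_y Q x y * phi y * g y = lambda * g x.
Hypothesis mE : measurable E.
Hypothesis E_weight : forall w, E w -> 1 <= \prod_(1 <= i < n.+1) phi (X i w).

(** The right-hand side replaces the conditional probability of E given the
    prefix by the value of a martingale that dominates it. It is proved by
    decreasing induction on k, the number m of remaining steps being the
    induction variable. *)
Lemma prefix_event_bound (x0 : S) (m k : nat) (s : nat -> S) :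
  (forall y, g x0 <= g y) -> (k + m)%N = n ->
  fine (Pr (prefix_event s k `&` E)) <=
  fine (Pr (prefix_event s k)) *
    ((\prod_(1 <= i < k.+1) phi (s i)) * lambda ^+ m * (g (s k) / g x0)).
Proof.
move=> g_min; elim: m k s => [|m IHm] k s km.
  rewrite addn0 in km; rewrite {}km expr0 mulr1 {k}.
  have [[w [sw Ew]]|empty] := pselect (prefix_event s n `&` E !=set0).
    apply: (@le_trans _ _ (fine (Pr (prefix_event s n)))).
      apply: fine_le; rewrite ?fin_num_measure //.
      - by apply: measurableI => //; exact: prefix_event_measurable.
      - exact: prefix_event_measurable.
      - apply: le_measure; rewrite ?inE; last by move=> ? [].
          by apply: measurableI => //; exact: prefix_event_measurable.
        exact: prefix_event_measurable.
    rewrite ler_peMr ?fine_ge0 //; apply: mulr_ege1.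
      have -> : \prod_(1 <= i < n.+1) phi (s i) = \prod_(1 <= i < n.+1) phi (X i w).
        by apply: eq_big_nat => i /andP[_]; rewrite ltnS => /sw->.
      exact: E_weight.
    by rewrite ler_pdivlMr ?mul1r.
  move/set0P/negP/negPn/eqP: empty => ->; rewrite measure0.
  rewrite mulr_ge0 ?fine_ge0 // mulr_ge0 ?divr_ge0 ?(ltW (g_gt0 _)) //.
  by apply: prodr_ge0.
pose ext y i := if (i <= k)%N then s i else y.
have ext_prefix y : prefix_event (ext y) k = prefix_event s k.
  by apply/seteqP; split=> w sw i ik; rewrite sw // /ext ik.
have mext y j : measurable (prefix_event (ext y) j).
  exact: prefix_event_measurable.
apply: (@le_trans _ _ (\sum_y fine (Pr (prefix_event (ext y) k.+1 `&` E)))).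
  apply: probability_cover_le => [|y|w [sw Ew]].
  - by apply: measurableI => //; exact: prefix_event_measurable.
  - exact: measurableI.
  - exists (X k.+1 w); split=> // i; rewrite leq_eqVlt ltnS => /orP[/eqP->|ik].
      by rewrite /ext ltnn.
    by rewrite /ext ik sw.
have step y : fine (Pr (prefix_event (ext y) k.+1 `&` E)) <=
    fine (Pr (prefix_event s k)) * (Q (s k) y *
    ((\prod_(1 <= i < k.+1) phi (s i)) * phi y * lambda ^+ m * (g y / g x0))).
  have := IHm k.+1 (ext y); rewrite addSnnS => /(_ km) /le_trans; apply.
  have -> : fine (Pr (prefix_event (ext y) k.+1)) =
      fine (Pr (prefix_event s k)) * Q (s k) y.
    rewrite /prefix_event X_markov.2 -/(prefix_event (ext y) k) ext_prefix.
    rewrite fineM ?fin_num_measure //; last exact: prefix_event_measurable.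
    by rewrite /ext leqnn ltnn.
  rewrite -mulrA big_nat_recr //= {2 3}/ext ltnn.
  have -> : \prod_(1 <= i < k.+1) phi (ext y i) = \prod_(1 <= i < k.+1) phi (s i).
    by apply: eq_big_nat => i /andP[_]; rewrite ltnS /ext => ->.
  by [].
apply: le_trans (ler_sum _ (fun y _ => step y)) _.
rewrite -mulr_sumr; rewrite le_eqVlt; apply/orP; left; apply/eqP; congr (_ * _).
set w := \prod_(1 <= i < k.+1) phi (s i).
transitivity (w * lambda ^+ m / g x0 * \sum_y Q (s k) y * phi y * g y).
  by rewrite mulr_sumr; apply: eq_bigr => y _; ring.
by rewrite g_eigen exprSr; ring.
Qed.

(** The bound for prefixes of length zero holds whatever the initial state,
    hence so does its average over any initial law. *)
Theorem markov_chain_exponential_bound (K : R) (x0 : S) :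
  (forall x y, g x <= K * g y) -> (Pr E <= (K * lambda ^+ n)%:E)%E.
Proof.
move=> gK; case: (arg_minP g (i0 := x0) (P := xpredT) isT) => x1 _ g_min.
have mX x : measurable (X 0%N @^-1` [set x]) by exact: X_markov.1.
have prefix0 x : prefix_event (fun=> x) 0 = X 0%N @^-1` [set x].
  apply/seteqP; split=> w /=; first by move=> /(_ 0%N (leqnn 0)).
  by move=> <- i; rewrite leqn0 => /eqP->.
have lambda_ge0 : 0 <= lambda.
  rewrite -(pmulr_lge0 _ (g_gt0 x0)) -g_eigen; apply: sumr_ge0 => y _.
  by rewrite !mulr_ge0 // ltW.
have sum1 : \sum_x fine (Pr (X 0%N @^-1` [set x])) = 1.
  apply: EFin_inj; rewrite -sumEFin.
  under eq_bigr do rewrite fineK ?fin_num_measure //.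
  rewrite fsbig_seq ?index_enum_uniq // -measure_fin_bigcup //.
  - rewrite -(@probability_setT _ _ _ Pr); congr (Pr _).
    apply/seteqP; split=> // w _; exists (X 0%N w) => //=.
    exact: mem_index_enum.
  - by move=> x y _ _ [w [/= <- <-]].
rewrite -(fineK (fin_num_measure Pr _ mE)) lee_fin.
apply: (@le_trans _ _ (\sum_x fine (Pr (X 0%N @^-1` [set x] `&` E)))).
  apply: probability_cover_le => // [x|w Ew]; first exact: measurableI.
  by exists (X 0%N w).
apply: (@le_trans _ _ (\sum_x fine (Pr (X 0%N @^-1` [set x])) * (K * lambda ^+ n))).
  apply: ler_sum => x _; rewrite -prefix0.
  apply: le_trans (prefix_event_bound (fun=> x) _ (add0n n)) _.
    by move=> y; exact: g_min.
  rewrite big_geq // mul1r ler_wpM2l ?fine_ge0 // mulrC ler_wpM2r ?exprn_ge0 //.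
  by rewrite ler_pdivrMr.
by rewrite -mulr_suml sum1 mul1r.
Qed.

End MarkovChainBound.

(** * Divergence between transition kernels *)

Section Divergence.
Variables (R : realType).

Lemma ln_lt_sub1 (t : R) : 0 < t -> t != 1 -> ln t < t - 1.
Proof.
move=> t_gt0 t_neq1; have := @expR_gt1Dx R (ln t).
by rewrite ln_eq0 // lnK ?posrE // ltrBrDl => /(_ t_neq1).
Qed.

Lemma entropy_term_lt (p q : R) : 0 <= p -> 0 <= q -> (q = 0 -> p = 0) ->
  p != q -> p - q < p * ln (p / q).
Proof.
move=> p_ge0 q_ge0 ac p_neq_q.
have q_gt0 : 0 < q.
  by rewrite lt_def q_ge0 andbT; apply: contra_neq p_neq_q => q0; rewrite ac.
have [p0|p_neq0] := eqVneq p 0; first by rewrite p0 !mul0r sub0r oppr_lt0.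
have p_gt0 : 0 < p by rewrite lt_def p_neq0.
rewrite -invf_div lnV ?posrE ?divr_gt0 // mulrN ltrNr opprB.
have lt_ln : ln (q / p) < q / p - 1.
  apply: ln_lt_sub1; first exact: divr_gt0.
  by apply: contra_neq p_neq_q => qp1; rewrite -[RHS](divfK p_neq0) qp1 mul1r.
have -> : q - p = p * (q / p - 1) by field.
by rewrite ltr_pM2l.
Qed.

Lemma entropy_term_ge (p q : R) : 0 <= p -> 0 <= q -> (q = 0 -> p = 0) ->
  p - q <= p * ln (p / q).
Proof.
move=> p_ge0 q_ge0 ac; have [->|p_neq_q] := eqVneq p q.
  have [->|q_neq0] := eqVneq q 0; first by rewrite subrr mul0r.
  by rewrite mulfV // ln1 mulr0 subrr.
exact/ltW/entropy_term_lt.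
Qed.

(** With ln t <= t - 1 the divergence is at most the chi-square divergence;
    p - q is kept apart because it sums to zero over a row. *)
Lemma entropy_term_le (e p q : R) : 0 <= p -> 0 <= q -> `|p - q| <= e * q ->
  p * ln (p / q) <= e ^+ 2 * q + (p - q).
Proof.
move=> p_ge0 q_ge0 pq.
have [q0|q_neq0] := eqVneq q 0.
  move: pq; rewrite q0 mulr0 subr0 normr_le0 => /eqP->.
  by rewrite !mul0r mulr0 addr0.
have q_gt0 : 0 < q by rewrite lt_def q_neq0.
apply: (@le_trans _ _ (p * (p / q - 1))).
  have [->|p_neq0] := eqVneq p 0; first by rewrite !mul0r.
  have p_gt0 : 0 < p by rewrite lt_def p_neq0.
  have -> : ln (p / q) = ln (1 + (p / q - 1)) by rewrite addrC subrK.
  rewrite ler_pM2l //.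
  apply: le_ln1Dx.
  by rewrite ltrBrDl subrr divr_gt0.
have -> : p * (p / q - 1) = (`|p - q| / q) ^+ 2 * q + (p - q).
  by rewrite exprMn real_normK ?num_real //; field.
rewrite lerD2r ler_pM2r // lerXn2r ?nnegrE ?divr_ge0 //.
  by rewrite -(pmulr_lge0 _ q_gt0); exact: le_trans pq.
by rewrite ler_pdivrMr.
Qed.

Lemma close_of_ratio_bounds (b p q : R) : 0 <= p -> 0 <= q ->
  2^-1 <= b -> b <= 1 -> b * q <= p -> b * p <= q -> `|p - q| <= 2 * (1 - b) * q.
Proof.
move=> p_ge0 q_ge0 b_ge b_le bq bp; rewrite ler_norml; apply/andP; split; first by nra.
have : (3 - 2 * b) * (b * p) <= (3 - 2 * b) * q by rewrite ler_wpM2l //; lra.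
have : 0 <= (2 * b - 1) * (1 - b) * p by rewrite !mulr_ge0 //; lra.
by nra.
Qed.

Variables (S : finType) (pi : S -> R) (p q : S -> S -> R).
Hypothesis pi_ge0 : forall x, 0 <= pi x.
Hypothesis p_ge0 : forall x y, 0 <= p x y.
Hypothesis q_ge0 : forall x y, 0 <= q x y.
Hypothesis p_sum : forall x, \sum_y p x y = 1.
Hypothesis q_sum : forall x, \sum_y q x y = 1.

Definition divergence : R := \sum_x \sum_y pi x * p x y * ln (p x y / q x y).

(** Rows of p and of q have the same sum. Subtracting p - q makes every term
    nonnegative. *)
Lemma divergence_excess : divergence =
  \sum_x \sum_y pi x * (p x y * ln (p x y / q x y) - (p x y - q x y)).
Proof.
apply: eq_bigr => x _; rewrite -mulr_sumr sumrB sumrB p_sum q_sum subrr subr0.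
by rewrite mulr_sumr; apply: eq_bigr => y _; rewrite mulrA.
Qed.

Lemma divergence_le (e : R) : \sum_x pi x = 1 ->
  (forall x y, `|p x y - q x y| <= e * q x y) -> divergence <= e ^+ 2.
Proof.
move=> pi_sum pq; rewrite divergence_excess.
have -> : e ^+ 2 = \sum_x \sum_y pi x * (e ^+ 2 * q x y).
  rewrite -[LHS]mul1r -pi_sum mulr_suml; apply: eq_bigr => x _.
  by rewrite -mulr_sumr -mulr_sumr q_sum mulr1.
apply: ler_sum => x _; apply: ler_sum => y _; rewrite ler_wpM2l //.
by rewrite lerBlDr entropy_term_le.
Qed.

Hypothesis pq_ac : forall x y, q x y = 0 -> p x y = 0.

Lemma divergence_ge0 : 0 <= divergence.
Proof.
rewrite divergence_excess; apply: sumr_ge0 => x _; apply: sumr_ge0 => y _.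
by rewrite mulr_ge0 // subr_ge0 entropy_term_ge //; exact: pq_ac.
Qed.

Lemma divergence_eq0 : (forall x, 0 < pi x) -> divergence = 0 ->
  forall x y, p x y = q x y.
Proof.
move=> pi_gt0; rewrite divergence_excess => div0 x y.
have term_ge0 a b :
    0 <= pi a * (p a b * ln (p a b / q a b) - (p a b - q a b)).
  by rewrite mulr_ge0 // subr_ge0 entropy_term_ge //; exact: pq_ac.
have row_ge0 a : true ->
    0 <= \sum_b pi a * (p a b * ln (p a b / q a b) - (p a b - q a b)).
  by move=> _; exact: sumr_ge0.
have rows0 := psumr_eq0P row_ge0 div0.
have terms0 := psumr_eq0P (fun b _ => term_ge0 x b) (rows0 x isT).
move/eqP: (terms0 y isT); rewrite mulf_eq0 gt_eqF //= subr_eq0 => /eqP eqpq.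
apply: contrapT => /eqP p_neq_q.
have := entropy_term_lt (p_ge0 x y) (q_ge0 x y) (pq_ac (y := y)) p_neq_q.
by rewrite eqpq ltxx.
Qed.

(** This is the normalization of the rows of p. *)
Lemma tilt_eigen (phi g : S -> R) (lambda : R) :
  (forall x, 0 < g x) -> 0 < lambda ->
  (forall x y, p x y = q x y * phi y * g y / (lambda * g x)) ->
  forall x, \sum_y q x y * phi y * g y = lambda * g x.
Proof.
move=> g_gt0 lambda_gt0 pE x.
have lg_neq0 : lambda * g x != 0 by rewrite gt_eqF // mulr_gt0.
apply: (mulIf (invr_neq0 lg_neq0)); rewrite mulfV // -(p_sum x) mulr_suml.
by apply: eq_bigr => y _; rewrite pE.
Qed.

(** The term ln g(y) - ln g(x) is a coboundary, which the invariant law does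
    not see. *)
Lemma divergence_tilt (phi g : S -> R) (lambda : R) :
  \sum_x pi x = 1 -> (forall y, \sum_x pi x * p x y = pi y) ->
  (forall x, 0 < g x) -> 0 < lambda -> (forall y, 0 <= phi y) ->
  (forall x y, p x y = q x y * phi y * g y / (lambda * g x)) ->
  divergence = \sum_x pi x * ln (phi x) - ln lambda.
Proof.
move=> pi_sum pi_inv g_gt0 lambda_gt0 phi_ge0 pE.
have termE x y : pi x * p x y * ln (p x y / q x y) =
    pi x * p x y * (ln (phi y) + ln (g y)) - pi x * p x y * (ln lambda + ln (g x)).
  have [p0|p_neq0] := eqVneq (p x y) 0; first by rewrite p0 !mulr0 !mul0r subr0.
  have q_neq0 : q x y != 0 by apply: contra_neq p_neq0 => /pq_ac.
  have phi_gt0 : 0 < phi y.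
    rewrite lt_def phi_ge0 andbT; apply: contra_neq p_neq0 => phi0.
    by rewrite pE phi0 mulr0 !mul0r.
  rewrite -mulrBr; congr (_ * _).
  have -> : p x y / q x y = phi y * g y / (lambda * g x).
    by rewrite pE; field; rewrite q_neq0 !gt_eqF.
  by rewrite ln_div ?lnM // ?posrE ?mulr_gt0.
rewrite /divergence.
under eq_bigr do (under eq_bigr do rewrite termE); rewrite /=.
under eq_bigr do rewrite sumrB; rewrite sumrB.
have -> : \sum_x \sum_y pi x * p x y * (ln (phi y) + ln (g y)) =
    \sum_y pi y * (ln (phi y) + ln (g y)).
  rewrite exchange_big; apply: eq_bigr => y _ /=.
  by rewrite -mulr_suml pi_inv.
have -> : \sum_x \sum_y pi x * p x y * (ln lambda + ln (g x)) =
    \sum_x pi x * (ln lambda + ln (g x)).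
  by apply: eq_bigr => x _; rewrite -mulr_suml -mulr_sumr p_sum mulr1.
rewrite [X in _ = _ - X](_ : _ = \sum_x pi x * ln lambda); last first.
  by rewrite -mulr_suml pi_sum mul1r.
by rewrite -!sumrB; apply: eq_bigr => x _; ring.
Qed.

End Divergence.

(** * Eigenvectors along the positivity graph *)

Section Propagation.
Variables (R : realType) (S : finType).

(** A path without repetition has fewer than #|S| steps. *)
Lemma connect_growth (e : rel S) (c : R) (D : S -> R) (x y : S) :
  1 <= c -> (forall a, 0 <= D a) -> (forall a b, e a b -> D b <= c * D a) ->
  connect e x y -> D y <= c ^+ #|S| * D x.
Proof.
move=> c_ge1 D_ge0 De /connectP[p0 /shortenP[p ep p_uniq _] ->] {p0}.
have c_ge0 : 0 <= c by exact: le_trans ler01 c_ge1.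
apply: (@le_trans _ _ (c ^+ size p * D x)); last first.
  rewrite ler_wpM2r // ler_weXn2l // ltnW // -[(size p).+1]/(size (x :: p)).
  by rewrite -(card_uniqP p_uniq) max_card.
elim: p x ep {p_uniq} => [|z p IHp] x /=; first by rewrite mul1r.
case/andP => exz /IHp /le_trans; apply.
by rewrite exprSr -mulrA ler_wpM2l ?exprn_ge0 // De.
Qed.

Lemma maximizer (D : S -> R) (K : {set S}) (x0 : S) : x0 \in K ->
  exists2 x, x \in K & forall y, y \in K -> D y <= D x.
Proof. by move=> x0K; case: (arg_maxP D x0K) => x xK xmax; exists x. Qed.

Lemma minimizer (D : S -> R) (K : {set S}) (x0 : S) : x0 \in K ->
  exists2 x, x \in K & forall y, y \in K -> D x <= D y.
Proof. by move=> x0K; case: (arg_minP D x0K) => x xK xmin; exists x. Qed.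

Lemma edge_lower_bound (W : S -> S -> R) : exists delta : R,
  [/\ 0 < delta, delta <= 1 & forall x y, 0 < W x y -> delta <= W x y].
Proof.
pose F (xy : S * S) := if 0 < W xy.1 xy.2 then W xy.1 xy.2 else 1.
have [|e [e_gt0 e_le]] := @positive_lower_bound R _ F.
  by move=> [x y]; rewrite /F /=; case: ifP.
exists (Num.min e 1); split; first by rewrite lt_min e_gt0 ltr01.
  by rewrite ge_min lexx orbT.
by move=> x y Wxy; have := e_le (x, y); rewrite /F /= Wxy ge_min => ->.
Qed.

(** Along an edge starting at a minimizer of g on K the value of g cannot
    decrease, and along an edge starting at a maximizer it cannot increase. *)
Lemma closed_class_growth_rate (K : {set S}) (g : S -> R) (a lambda : R) (x0 : S) :
  x0 \in K -> 0 < a -> (forall x, 0 < g x) ->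
  (forall x, x \in K -> exists2 y, y \in K & a * g y = lambda * g x) ->
  a = lambda.
Proof.
move=> x0K a_gt0 g_gt0 step; apply/eqP; rewrite eq_le; apply/andP; split.
  have [x xK x_min] := minimizer g x0K; have [y yK gy] := step x xK.
  by rewrite -(ler_pM2r (g_gt0 x)) -gy ler_pM2l // x_min.
have [x xK x_max] := maximizer g x0K; have [y yK gy] := step x xK.
by rewrite -(ler_pM2r (g_gt0 x)) -gy ler_pM2l // x_max.
Qed.

Lemma uniform_decay (K : {set S}) (D : S -> R) (e : R) : 0 < e ->
  (forall y, y \notin K -> 0 < D y) ->
  exists2 T : R, 0 <= T &
    forall t y, T <= t -> y \notin K -> expR (- (t * D y)) <= e.
Proof.
move=> e_gt0 D_gt0.
have [|d [d_gt0 d_le]] := @positive_lower_bound R _ (fun y => if y \in K then 1 else D y).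
  by move=> y; case: ifP => // /negbT; exact: D_gt0.
have T_ge0 : 0 <= `|ln e| / d by rewrite divr_ge0 // ltW.
exists (`|ln e| / d) => // t y Tt yK.
have dD : d <= D y by have := d_le y; rewrite (negPf yK).
rewrite -[leRHS](lnK e_gt0) ler_expR lerNl.
apply: le_trans (ler_norm _) _; rewrite normrN.
apply: (@le_trans _ _ (`|ln e| / d * D y)).
  by rewrite mulrAC ler_pdivlMr // ler_wpM2l.
by rewrite ler_wpM2r // ltW // D_gt0.
Qed.

Lemma connected_eigenvector_ratio (W : S -> S -> R) (v : S -> R) (r e : R) :
  (forall x y, 0 <= W x y) -> (forall x y, connect (positive_edge W) x y) ->
  (forall x, 0 < v x) -> 0 < r -> right_eigenvector W r v ->
  0 < e -> e <= 1 -> (forall x y, 0 < W x y -> e * r <= W x y) ->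
  forall x y, v x <= e^-1 ^+ #|S| * v y.
Proof.
move=> W_ge0 W_conn v_gt0 r_gt0 Wv e_gt0 e_le1 We x y.
apply: connect_growth (W_conn y x) => [|z|a b Wab].
- by rewrite invf_ge1.
- exact: ltW.
- rewrite -ler_pdivrMl ?invr_gt0 // invrK -(ler_pM2l r_gt0) mulrA [r * e]mulrC -Wv.
  apply: (@le_trans _ _ (W a b * v b)); first by rewrite ler_pM2r // We.
  rewrite (bigD1 b) //= lerDl; apply: sumr_ge0 => z _.
  by rewrite mulr_ge0 // ltW.
Qed.

Section DominantCore.
Variables (Q : S -> S -> R) (K : {set S}) (delta : R) (w v : S -> R) (r : R).
Hypothesis Q_ge0 : forall x y, 0 <= Q x y.
Hypothesis Q_sum : forall x, \sum_y Q x y = 1.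
Hypothesis K_edge : forall x, exists y, 0 < Q x y /\ y \in K.
Hypothesis K_connect : forall x y, y \in K ->
  connect (fun a b => (0 < Q a b) && (b \in K)) x y.
Hypothesis delta_gt0 : 0 < delta.
Hypothesis delta_le1 : delta <= 1.
Hypothesis Q_delta : forall x y, 0 < Q x y -> delta <= Q x y.
Hypothesis w_ge0 : forall y, 0 <= w y.
Hypothesis w_le1 : forall y, w y <= 1.
Hypothesis w_K : forall y, y \in K -> w y = 1.
Hypothesis w_off_K : forall y, y \notin K -> w y <= delta / 2.
Hypothesis v_gt0 : forall x, 0 < v x.
Hypothesis v_eigen : forall x, \sum_y Q x y * w y * v y = r * v x.

Lemma core_edge_le x y : 0 < Q x y -> y \in K -> delta * v y <= r * v x.
Proof.
move=> Qxy yK; rewrite -v_eigen (bigD1 y) //= w_K // mulr1.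
apply: (@le_trans _ _ (Q x y * v y)); first by rewrite ler_pM2r // Q_delta.
by rewrite lerDl; apply: sumr_ge0 => z _; rewrite !mulr_ge0 // ltW.
Qed.

(** Rows sum to one and w <= 1, so r <= 1; the weight is 1 on K, so
    r >= delta. Following edges into K bounds v from below everywhere by its
    values on K. Conversely, at a global maximizer of v the states off K
    contribute at most delta / 2 * max v to r * v, hence the values on K must
    account for the rest. *)
Lemma dominant_core_ratio x y :
  v x <= 2 / delta * delta^-1 ^+ #|S| * v y.
Proof.
have [x1 _ x1_max] := maximizer v (finset.in_setT x).
have {}x1_max z : v z <= v x1 by exact: x1_max.
have [k0 [_ k0K]] := K_edge x.
have r_le1 : r <= 1.
  rewrite -(ler_pM2r (v_gt0 x1)) -v_eigen -(Q_sum x1) mulr_suml.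
  apply: ler_sum => z _; apply: ler_pM => //; first exact: mulr_ge0.
    exact: ltW.
  by rewrite ler_piMr.
have r_ge : delta <= r.
  have [z zK z_min] := minimizer v k0K; have [z' [Qz z'K]] := K_edge z.
  rewrite -(ler_pM2r (v_gt0 z)); apply: le_trans (core_edge_le Qz z'K).
  by rewrite ler_pM2l // z_min.
have [k kK k_max] := maximizer v k0K.
have vk : v k <= delta^-1 ^+ #|S| * v y.
  apply: connect_growth (K_connect y kK) => [|z|a b /andP[Qab bK]].
  - by rewrite invf_ge1.
  - exact: ltW.
  - rewrite -ler_pdivrMl ?invr_gt0 // invrK.
    by apply: le_trans (core_edge_le Qab bK) _; rewrite ler_piMl // ltW.
apply: (@le_trans _ _ (2 / delta * v k)); last first.
  by rewrite -[leRHS]mulrA ler_pM2l // divr_gt0.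
apply: le_trans (x1_max x) _.
have upper : r * v x1 <= v k + delta / 2 * v x1.
  apply: (@le_trans _ _ (\sum_z Q x1 z * (v k + delta / 2 * v x1))); last first.
    by rewrite -mulr_suml Q_sum mul1r.
  rewrite -v_eigen; apply: ler_sum => z _.
  rewrite -mulrA ler_wpM2l //; have [zK|zK] := boolP (z \in K).
    rewrite w_K // mul1r; apply: le_trans (k_max z zK) _.
    by rewrite lerDl ltW // mulr_gt0 ?divr_gt0.
  apply: (@le_trans _ _ (delta / 2 * v x1)); last by rewrite lerDr ltW.
  by apply: ler_pM; rewrite ?w_off_K ?x1_max ?w_ge0 ?ltW.
have : delta * v x1 <= r * v x1 by rewrite ler_pM2r.
move=> /le_trans/(_ upper) half.
rewrite mulrAC ler_pdivlMr // [_ * delta]mulrC; lra.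
Qed.

End DominantCore.

Section TiltPerturbation.
Variables (Q : S -> S -> R) (f : S -> R) (F delta : R).
Hypothesis Q_ge0 : forall x y, 0 <= Q x y.
Hypothesis Q_sum : forall x, \sum_y Q x y = 1.
Hypothesis Q_connect : forall x y, connect (positive_edge Q) x y.
Hypothesis delta_gt0 : 0 < delta.
Hypothesis Q_delta : forall x y, 0 < Q x y -> delta <= Q x y.
Hypothesis f_bound : forall x, `|f x| <= F.

Variables (h lambda : R) (g : S -> R).
Hypothesis g_gt0 : forall x, 0 < g x.
Hypothesis g_eigen : forall x, \sum_y Q x y * expR (h * f y) * g y = lambda * g x.

Let A := expR (`|h| * F).

Lemma tilt_le x : expR (h * f x) <= A.
Proof.
rewrite ler_expR; apply: le_trans (ler_norm _) _.
by rewrite normrM ler_wpM2l.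
Qed.

Lemma tilt_ge x : A^-1 <= expR (h * f x).
Proof.
rewrite /A -expRN ler_expR lerNl; apply: le_trans (ler_norm _) _.
by rewrite normrN normrM ler_wpM2l.
Qed.

Lemma tilt_eigenvalue_le (x0 : S) : lambda <= A.
Proof.
have [x _ xmax] := maximizer g (finset.in_setT x0).
rewrite -(ler_pM2r (g_gt0 x)) -g_eigen.
apply: (@le_trans _ _ (\sum_y Q x y * (A * g x))).
  apply: ler_sum => y _; rewrite -mulrA ler_wpM2l //.
  by apply: ler_pM => //; [exact: ltW | exact: tilt_le | exact: xmax].
by rewrite -mulr_suml Q_sum mul1r.
Qed.

Lemma tilt_eigenvalue_ge (x0 : S) : A^-1 <= lambda.
Proof.
have [x _ xmin] := minimizer g (finset.in_setT x0).
rewrite -(ler_pM2r (g_gt0 x)) -g_eigen.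
apply: (@le_trans _ _ (\sum_y Q x y * (A^-1 * g x))).
  by rewrite -mulr_suml Q_sum mul1r.
apply: ler_sum => y _; rewrite -mulrA ler_wpM2l //.
apply: ler_pM => //; last exact: xmin.
- by rewrite invr_ge0 expR_ge0.
- exact: ltW.
- exact: tilt_ge.
Qed.

Let kappa := 2 * (`|h| * F).

Lemma tilt_sqr_ge : 1 - kappa <= A^-1 * A^-1.
Proof.
rewrite /A -expRN -expRD.
rewrite (_ : - (`|h| * F) - `|h| * F = - kappa); last by rewrite /kappa; ring.
exact: expR_ge1Dx.
Qed.

(** At a maximizer x1 of g the eigenvector equation has almost no room: if
    g(a) is close to the maximum, then so is g(b) for every edge from a to b.
    The quantity g(x1) - g + kappa * g(x1) is thus multiplied by at most
    1 / delta + 1 along an edge; the added term makes this recursion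
    homogeneous. *)
Lemma tilt_oscillation (x y : S) :
  (1 - (delta^-1 + 1) ^+ #|S| * kappa) * g x <= g y.
Proof.
set s := _ * kappa.
have F_ge0 : 0 <= F by apply: le_trans (f_bound x).
have kappa_ge0 : 0 <= kappa by rewrite !mulr_ge0.
have [x1 _ xmax] := maximizer g (finset.in_setT x).
have {}xmax z : g z <= g x1 by apply: xmax.
pose D z := g x1 - g z + kappa * g x1.
have kg_ge0 : 0 <= kappa * g x1 by rewrite mulr_ge0 // ltW.
have D_ge z : kappa * g x1 <= D z by rewrite lerDr subr_ge0.
have Ainv_gt0 : 0 < A^-1 by rewrite invr_gt0 expR_gt0.
have A_gt0 : 0 < A by rewrite expR_gt0.
have step a b : positive_edge Q a b -> D b <= (delta^-1 + 1) * D a.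
  move=> Qab.
  have upper : A^-1 * A^-1 * g a <= g x1 - delta * (g x1 - g b).
    apply: (@le_trans _ _ (\sum_z Q a z * g z)).
      rewrite -mulrA ler_pdivrMl //.
      apply: (@le_trans _ _ (lambda * g a)).
        by rewrite ler_pM2r // (tilt_eigenvalue_ge x).
      rewrite -g_eigen mulr_sumr; apply: ler_sum => z _.
      rewrite mulrA [A * _]mulrC ler_pM2r //.
      by rewrite ler_wpM2l // tilt_le.
    have -> : \sum_z Q a z * g z = g x1 - \sum_z Q a z * (g x1 - g z).
      under [in RHS]eq_bigr do rewrite mulrBr.
      by rewrite sumrB -mulr_suml Q_sum mul1r subKr.
    rewrite lerD2l lerN2; apply: (@le_trans _ _ (Q a b * (g x1 - g b))).
      by rewrite ler_wpM2r ?subr_ge0 // Q_delta.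
    rewrite [leRHS](bigD1 b) //= lerDl; apply: sumr_ge0 => z _.
    by rewrite mulr_ge0 // subr_ge0.
  have lower : (1 - kappa) * g a <= A^-1 * A^-1 * g a.
    by rewrite ler_pM2r // tilt_sqr_ge.
  have ka : kappa * g a <= kappa * g x1 by rewrite ler_wpM2l.
  have {upper lower ka} : delta * (g x1 - g b) <= D a.
    by rewrite /D; nra.
  rewrite -ler_pdivlMl // mulrDl mul1r => db.
  by rewrite {1}/D; apply: lerD.
have Dy := connect_growth _ _ step (Q_connect x1 y).
have {Dy} : D y <= s * g x1.
  apply: le_trans (Dy _ _) _.
  - by rewrite lerDr invr_ge0 ltW.
  - by move=> z; exact: le_trans (D_ge z).
  - by rewrite /D subrr add0r mulrA.
rewrite /D => Dy; have [s_le1|s_gt1] := lerP s 1.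
  apply: (@le_trans _ _ ((1 - s) * g x1)).
    by rewrite ler_wpM2l ?subr_ge0.
  by lra.
by apply: (@le_trans _ _ 0); [rewrite nmulr_rle0 ?ltW // subr_lt0 | exact: ltW].
Qed.

(** The quotient of exp(h f(y)) g(y) by lambda g(x) is the density of the
    perturbed kernel; it is within O(h) of 1. *)
Lemma tilt_density_bounds (x y : S) :
  let b := 1 - (1 + (delta^-1 + 1) ^+ #|S|) * kappa in
  b * (lambda * g x) <= expR (h * f y) * g y /\
  b * (expR (h * f y) * g y) <= lambda * g x.
Proof.
set s := (delta^-1 + 1) ^+ #|S| * kappa; move=> b.
have bE : b = 1 - kappa - s by rewrite /b mulrDl mul1r opprD addrA.
have F_ge0 : 0 <= F by apply: le_trans (f_bound x).
have kappa_ge0 : 0 <= kappa by rewrite !mulr_ge0.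
have s_ge0 : 0 <= s by rewrite mulr_ge0 // exprn_ge0 // addr_ge0 // invr_ge0 ltW.
have A_gt0 : 0 < A by rewrite expR_gt0.
have lambda_gt0 : 0 < lambda.
  by apply: lt_le_trans (tilt_eigenvalue_ge x); rewrite invr_gt0.
have [b_le0|b_gt0] := lerP b 0.
  split; (apply: (@le_trans _ _ 0); last by rewrite mulr_ge0 ?expR_ge0 // ltW).
    by rewrite mulr_le0_ge0 // mulr_ge0 // ltW.
  by rewrite mulr_le0_ge0 // mulr_ge0 ?expR_ge0 // ltW.
have bAA z z' : b * A * A * g z <= g z'.
  apply: le_trans (tilt_oscillation z z'); rewrite ler_pM2r // -/s.
  have s_lt1 : 0 <= 1 - s by lra.
  have b_le : b <= (1 - s) * (A^-1 * A^-1).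
    by have := tilt_sqr_ge; nra.
  apply: (@le_trans _ _ ((1 - s) * (A^-1 * A^-1) * A * A)).
    by rewrite !ler_pM2r.
  by rewrite le_eqVlt; apply/orP; left; apply/eqP; field; rewrite gt_eqF.
have bounds (t t' z z' : R) : 0 < z -> 0 < z' -> t <= A -> A^-1 <= t' ->
    b * A * A * z <= z' -> b * (t * z) <= t' * z'.
  move=> z_gt0 z'_gt0 tA At' bz.
  apply: (@le_trans _ _ (b * (A * z))).
    by rewrite ler_pM2l // ler_pM2r.
  apply: (@le_trans _ _ (A^-1 * z')); last by rewrite ler_pM2r.
  rewrite ler_pdivlMl //; apply: le_trans bz.
  by rewrite le_eqVlt; apply/orP; left; apply/eqP; ring.
split; apply: bounds => //.
- exact: tilt_eigenvalue_le x.
- exact: tilt_ge.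
- exact: tilt_le.
- exact: tilt_eigenvalue_ge x.
Qed.

End TiltPerturbation.

End Propagation.

(** * The exponential family *)

Section Extrema.
Variables (R : realType) (S : finType) (f : S -> R).
Local Open Scope classical_set_scope.

Lemma fmax_eq (x : S) : (forall y, f y <= f x) -> fmax f = f x.
Proof.
move=> x_max; have ub : ubound (range f) (f x) by move=> _ [y _ <-].
apply/eqP; rewrite eq_le; apply/andP; split.
  by apply: ge_sup => //; exists (f x), x.
by apply: ub_le_sup; [exists (f x) | exists x].
Qed.

Lemma fmin_eq (x : S) : (forall y, f x <= f y) -> fmin f = f x.
Proof.
move=> x_min; have lb : lbound (range f) (f x) by move=> _ [y _ <-].
apply/eqP; rewrite eq_le; apply/andP; split.
  by apply: ge_inf; [exists (f x) | exists x].
by apply: lb_le_inf => //; exists (f x), x.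
Qed.

Lemma fmax_attained (x0 : S) : exists2 x, x \in Smax f & forall y, f y <= f x.
Proof.
have [x _ x_max] := maximizer f (finset.in_setT x0).
have {}x_max y : f y <= f x by exact: x_max.
by exists x => //; rewrite inE (fmax_eq x_max).
Qed.

Lemma fmin_attained (x0 : S) : exists2 x, x \in Smin f & forall y, f x <= f y.
Proof.
have [x _ x_min] := minimizer f (finset.in_setT x0).
have {}x_min y : f x <= f y by exact: x_min.
by exists x => //; rewrite inE (fmin_eq x_min).
Qed.

Lemma le_fmax (x : S) : f x <= fmax f.
Proof. by have [y _ y_max] := fmax_attained x; rewrite (fmax_eq y_max). Qed.

Lemma ge_fmin (x : S) : fmin f <= f x.
Proof. by have [y _ y_min] := fmin_attained x; rewrite (fmin_eq y_min). Qed.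

Lemma Smax_eq (x : S) : x \in Smax f -> f x = fmax f.
Proof. by rewrite inE => /eqP. Qed.

Lemma Smin_eq (x : S) : x \in Smin f -> f x = fmin f.
Proof. by rewrite inE => /eqP. Qed.

Lemma fmin_lt_fmax : (exists x y, f x <> f y) -> fmin f < fmax f.
Proof.
move=> [x [y fxy]]; rewrite lt_neqAle (le_trans (ge_fmin x) (le_fmax x)) andbT.
apply/eqP => eq_mM; apply: fxy; apply/eqP; rewrite eq_le.
by rewrite !(le_trans (le_fmax _)) // -eq_mM ge_fmin.
Qed.

End Extrema.

Lemma nonneg_pair_vanish (R : realType) (k1 k2 h d : R) :
  0 <= k1 -> 0 <= k2 -> 0 < h -> d <= 0 -> k1 + k2 = h * d -> k2 = 0.
Proof.
move=> k1_ge0 k2_ge0 h_gt0 d_le0 k12.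
have hd : h * d <= 0 by rewrite pmulr_rle0.
by apply/eqP; rewrite eq_le k2_ge0 andbT (le_trans _ hd) // -k12 lerDr.
Qed.

Lemma density_ratio_bounds (R : realType) (b q z c : R) :
  0 <= q -> 0 < c -> b * c <= z -> b * z <= c ->
  b * q <= q * z / c /\ b * (q * z / c) <= q.
Proof.
move=> q_ge0 c_gt0 bc bz; split.
  by rewrite mulrC -mulrA ler_wpM2l // ler_pdivlMr.
rewrite (_ : b * (q * z / c) = q * (b * z / c)); last by ring.
by rewrite ler_piMr // ler_pdivrMr // mul1r.
Qed.

Section ExponentialFamily.
Variables (R : realType) (S : finType) (P : S -> S -> R) (f : S -> R).
Hypothesis f_nonconstant : exists x y, f x <> f y.
Hypothesis P_irreducible : irreducible P.
Hypothesis P_stochastic : stochastic P.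
Hypothesis Smax_irreducible : irreducible (@submatrix R S P (Smax f)).
Hypothesis Smin_irreducible : irreducible (@submatrix R S P (Smin f)).
Hypothesis reach_Smax :
  forall x, x \notin Smax f -> exists y, y \in Smax f /\ 0 < P x y.
Hypothesis reach_Smin :
  forall x, x \notin Smin f -> exists y, y \in Smin f /\ 0 < P x y.

Let P_ge0 : forall x y, 0 <= P x y := P_stochastic.1.

Lemma state_exists : exists x : S, True.
Proof. by have [x _] := f_nonconstant; exists x. Qed.

Lemma tilted_ge0 t x y : 0 <= tilted P f t x y.
Proof. by case: t => [r||] /=; rewrite mulr_ge0 ?expR_ge0. Qed.

Lemma tilted_edge_real (r : R) x y : (0 < tilted P f r%:E x y) = (0 < P x y).
Proof. by rewrite /= pmulr_lgt0 // expR_gt0. Qed.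

Lemma tilted_edge_pinfty x y :
  (0 < tilted P f +oo%E x y) = (0 < P x y) && (y \in Smax f).
Proof. by rewrite /=; case: (y \in _); rewrite ?mulr1 ?mulr0 ?ltxx ?andbT ?andbF. Qed.

(** The value -oo is left out: it is never the parameter of a mean that is at
    least the mean of a real parameter. *)
Lemma perron_pairP t : t != -oo%E ->
  0 < rho P f t /\ is_perron_pair P f t (perron_pair P f t).
Proof.
move=> t_neq; have [x0 _] := state_exists.
suff [rho_gt0 [u [v uvP]]] : 0 < rho P f t /\ exists u v, is_perron_pair P f t (u, v).
  by split=> //; apply: (xgetPex (fun=> 0, fun=> 0)); exists (u, v).
have edge x y : 0 < P x y -> y \in tilted_support f t -> 0 < tilted P f t x y.
  case: t t_neq => [r||] // _ Pxy yK; first by rewrite tilted_edge_real.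
  by rewrite tilted_edge_pinfty Pxy.
apply: (@perron_frobenius R S (tilted P f t) (tilted_ge0 t) (tilted_support f t)) => //.
- case: t t_neq {edge} => [r||] //= _ x y; first by rewrite finset.in_setT.
  by move=> /negPf->; rewrite mulr0.
- move=> x y yK; case: t t_neq edge yK => [r||] // _ edge yK.
    apply: connect_sub (irreducible_connect x y P_irreducible) => a b Pab.
    by apply: connect1; apply: edge => //; rewrite finset.in_setT.
  apply: connect_sub (core_connect Smax_irreducible reach_Smax x yK) => a b.
  by move=> /andP[Pab bK]; apply: connect1; exact: edge.
- move=> x; case: t t_neq edge => [r||] // _ edge.
    have [y Pxy] := irreducible_edge x P_irreducible.
    by exists y; apply: edge => //; rewrite finset.in_setT.
  have [y [Pxy yK]] := core_edge Smax_irreducible reach_Smax x.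
  by exists y; exact: edge.
Qed.

(* Unification must not compare the chosen witnesses at different parameters
   by unfolding them. *)
Local Opaque rho perron_pair.

Section PerronData.
Variables (t : \bar R).
Hypothesis t_neq : t != -oo%E.

Lemma rho_gt0 : 0 < rho P f t.
Proof. exact: (perron_pairP t_neq).1. Qed.

Lemma right_vec_gt0 x : 0 < right_vec P f t x.
Proof. by have [_ _ v_gt0 _ _] := (perron_pairP t_neq).2; exact: v_gt0. Qed.

Lemma right_vec_eigen x :
  \sum_y tilted P f t x y * right_vec P f t y = rho P f t * right_vec P f t x.
Proof. by have [[_ Wv] _ _ _ _] := (perron_pairP t_neq).2; exact: Wv. Qed.

Lemma left_vec_eigen y :
  \sum_x left_vec P f t x * tilted P f t x y = rho P f t * left_vec P f t y.
Proof. by have [[uW _] _ _ _ _] := (perron_pairP t_neq).2; exact: uW. Qed.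

Lemma stationary_ge0 x : 0 <= stationary P f t x.
Proof.
have [_ [u_gt0 u0] _ _ _] := (perron_pairP t_neq).2.
apply: mulr_ge0; last exact: ltW (right_vec_gt0 x).
by have [/u_gt0/ltW|/u0 ux] := boolP (x \in tilted_support f t); rewrite // /left_vec ux.
Qed.

Lemma stationary_sum : \sum_x stationary P f t x = 1.
Proof. by have [_ _ _ _ uv1] := (perron_pairP t_neq).2. Qed.

Lemma exp_family_ge0 x y : 0 <= exp_family P f t x y.
Proof.
by rewrite divr_ge0 ?mulr_ge0 ?tilted_ge0 ?ltW ?right_vec_gt0 ?rho_gt0.
Qed.

Lemma exp_family_sum x : \sum_y exp_family P f t x y = 1.
Proof.
rewrite -mulr_suml right_vec_eigen mulfV // gt_eqF // mulr_gt0 ?rho_gt0 //.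
exact: right_vec_gt0.
Qed.

Lemma stationary_invariant y :
  \sum_x stationary P f t x * exp_family P f t x y = stationary P f t y.
Proof.
transitivity (\sum_x (left_vec P f t x * tilted P f t x y) *
  (right_vec P f t y / rho P f t)).
  apply: eq_bigr => x _; rewrite /stationary /exp_family; field.
  by rewrite !gt_eqF ?rho_gt0 ?right_vec_gt0.
rewrite -mulr_suml left_vec_eigen /stationary; field.
by rewrite gt_eqF // rho_gt0.
Qed.

End PerronData.

Lemma real_neq_ninfty (r : R) : r%:E != -oo%E. Proof. by []. Qed.
Lemma pinfty_neq_ninfty : +oo%E != -oo%E :> \bar R. Proof. by []. Qed.
Hint Resolve real_neq_ninfty pinfty_neq_ninfty : core.

Lemma stationary_gt0 (r : R) x : 0 < stationary P f r%:E x.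
Proof.
have [_ [u_gt0 _] _ _ _] := (perron_pairP (real_neq_ninfty r)).2.
by rewrite mulr_gt0 ?right_vec_gt0 // u_gt0 // finset.in_setT.
Qed.

Lemma exp_family_eq0 (r : R) x y : (exp_family P f r%:E x y == 0) = (P x y == 0).
Proof.
rewrite /exp_family /= !mulf_eq0 invr_eq0 mulf_eq0.
by rewrite !(gt_eqF (right_vec_gt0 _ _)) // (gt_eqF (rho_gt0 _)) // expR_eq0 !orbF.
Qed.

Lemma exp_family_edge (r : R) x y : (0 < exp_family P f r%:E x y) = (0 < P x y).
Proof. by rewrite !lt_def exp_family_eq0 exp_family_ge0 // P_ge0. Qed.

Lemma exp_family_ac t (r : R) x y : t != -oo%E ->
  exp_family P f r%:E x y = 0 -> exp_family P f t x y = 0.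
Proof.
move=> t_neq /eqP; rewrite exp_family_eq0 => /eqP P0.
by case: t t_neq => [s||] // _; rewrite /exp_family /= P0 !mul0r.
Qed.

Lemma mean_lt_fmax (r : R) : mean P f r%:E < fmax f.
Proof.
have [x0 _] := state_exists.
have [x1 _ x1_min] := fmin_attained f x0.
rewrite -[ltRHS]mulr1 -(stationary_sum (real_neq_ninfty r)) mulr_sumr /=.
rewrite (bigD1 x1) //= [ltRHS](bigD1 x1) //=; apply: ltr_leD.
  rewrite ltr_pM2r ?stationary_gt0 // -(fmin_eq x1_min).
  exact: fmin_lt_fmax.
by apply: ler_sum => x _; rewrite ler_pM2r ?stationary_gt0 // le_fmax.
Qed.

Lemma fmin_lt_mean (r : R) : fmin f < mean P f r%:E.
Proof.
have [x0 _] := state_exists.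
have [x1 _ x1_max] := fmax_attained f x0.
rewrite -[ltLHS]mulr1 -(stationary_sum (real_neq_ninfty r)) mulr_sumr /=.
rewrite (bigD1 x1) //= [ltRHS](bigD1 x1) //=; apply: ltr_leD.
  rewrite ltr_pM2r ?stationary_gt0 // -(fmax_eq x1_max).
  exact: fmin_lt_fmax.
by apply: ler_sum => x _; rewrite ler_pM2r ?stationary_gt0 // ge_fmin.
Qed.

Lemma KL_tilt t (theta : R) (phi : S -> R) (lambda : R) :
  t != -oo%E -> 0 < lambda -> (forall y, 0 <= phi y) ->
  (forall x y, exp_family P f t x y = exp_family P f theta%:E x y * phi y *
    (right_vec P f t y / right_vec P f theta%:E y) /
    (lambda * (right_vec P f t x / right_vec P f theta%:E x))) ->
  KL P f t theta = \sum_x stationary P f t x * ln (phi x) - ln lambda.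
Proof.
move=> t_neq lambda_gt0 phi_ge0 tilt.
apply: (@divergence_tilt R S _ _ _ (exp_family_sum t_neq)
  (fun x y => @exp_family_ac t theta x y t_neq) phi
  (fun x => right_vec P f t x / right_vec P f theta%:E x)) => //.
- exact: stationary_sum.
- exact: stationary_invariant.
- by move=> x; rewrite divr_gt0 // right_vec_gt0.
Qed.

(** The factor exp(-(r - theta) * mu) occurs both in the weight of y and in
    the eigenvalue, so that the weight can be centred at any level mu. *)
Lemma exp_family_tilt_real (r theta mu : R) x y :
  exp_family P f r%:E x y =
  exp_family P f theta%:E x y * expR ((r - theta) * (f y - mu)) *
    (right_vec P f r%:E y / right_vec P f theta%:E y) /
    (expR (- ((r - theta) * mu)) * (rho P f r%:E / rho P f theta%:E) *
     (right_vec P f r%:E x / right_vec P f theta%:E x)).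
Proof.
have -> : expR ((r - theta) * (f y - mu)) =
    expR (r * f y) / expR (theta * f y) * expR (- ((r - theta) * mu)).
  by rewrite -expRB -expRD; congr expR; ring.
have v_neq0 t z : t != -oo%E -> right_vec P f t z != 0.
  by move=> t_neq; rewrite gt_eqF // right_vec_gt0.
have rho_neq0 t : t != -oo%E -> rho P f t != 0.
  by move=> t_neq; rewrite gt_eqF // rho_gt0.
rewrite /exp_family -[tilted P f r%:E x y]/(P x y * expR (r * f y)).
rewrite -[tilted P f theta%:E x y]/(P x y * expR (theta * f y)).
(* Only the algebra of the eigenvectors, radii and exponentials matters. *)
move: (v_neq0 r%:E x isT) (v_neq0 r%:E y isT) (v_neq0 theta%:E x isT)
  (v_neq0 theta%:E y isT) (rho_neq0 r%:E isT) (rho_neq0 theta%:E isT).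
move: (gt_eqF (expR_gt0 (theta * f y))) (gt_eqF (expR_gt0 (- ((r - theta) * mu)))).
move: (right_vec P f r%:E x) (right_vec P f r%:E y) (right_vec P f theta%:E x)
  (right_vec P f theta%:E y) (rho P f r%:E) (rho P f theta%:E)
  (expR (theta * f y)) (expR (- ((r - theta) * mu))) (expR (r * f y)).
move=> v1 v2 v3 v4 r1 r2 e1 e2 e3 /negbT ? /negbT ? *; field.
by do !(apply/andP; split).
Qed.

Lemma exp_family_tilt_pinfty (theta : R) x y :
  exp_family P f +oo%E x y =
  exp_family P f theta%:E x y * (y \in Smax f)%:R *
    (right_vec P f +oo%E y / right_vec P f theta%:E y) /
    (expR (theta * fmax f) * (rho P f +oo%E / rho P f theta%:E) *
     (right_vec P f +oo%E x / right_vec P f theta%:E x)).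
Proof.
have v_neq0 t z : t != -oo%E -> right_vec P f t z != 0.
  by move=> t_neq; rewrite gt_eqF // right_vec_gt0.
have rho_neq0 t : t != -oo%E -> rho P f t != 0.
  by move=> t_neq; rewrite gt_eqF // rho_gt0.
rewrite /exp_family -[tilted P f +oo%E x y]/(P x y * (y \in Smax f)%:R).
rewrite -[tilted P f theta%:E x y]/(P x y * expR (theta * f y)).
case: (boolP (y \in _)) => [/Smax_eq->|_]; last by rewrite !mulr0 !mul0r.
move: (v_neq0 +oo%E x isT) (v_neq0 +oo%E y isT) (v_neq0 theta%:E x isT)
  (v_neq0 theta%:E y isT) (rho_neq0 +oo%E isT) (rho_neq0 theta%:E isT).
move: (gt_eqF (expR_gt0 (theta * fmax f))).
move: (right_vec P f +oo%E x) (right_vec P f +oo%E y) (right_vec P f theta%:E x)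
  (right_vec P f theta%:E y) (rho P f +oo%E) (rho P f theta%:E)
  (expR (theta * fmax f)).
move=> v1 v2 v3 v4 r1 r2 e1 /negbT ? *; field.
by do !(apply/andP; split).
Qed.

Lemma KL_real (r theta : R) :
  KL P f r%:E theta = (r - theta) * mean P f r%:E
    - (ln (rho P f r%:E) - ln (rho P f theta%:E)).
Proof.
rewrite (KL_tilt _ _ _ (exp_family_tilt_real r theta 0)) //; last first.
  by rewrite mulr_gt0 ?expR_gt0 // divr_gt0 // rho_gt0.
rewrite mulr0 oppr0 expR0 mul1r ln_div ?posrE ?rho_gt0 //; congr (_ - _).
by rewrite /= mulr_sumr; apply: eq_bigr => x _; rewrite expRK addr0; ring.
Qed.

Lemma KL_pinfty (theta : R) :
  KL P f +oo%E theta =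
    - ln (expR (theta * fmax f) * (rho P f +oo%E / rho P f theta%:E)).
Proof.
rewrite (KL_tilt _ _ _ (exp_family_tilt_pinfty theta)) //; last first.
  by rewrite mulr_gt0 ?expR_gt0 // divr_gt0 // rho_gt0.
rewrite big1 ?sub0r // => x _; have [xM|xM] := boolP (x \in Smax f).
  by rewrite ln1 mulr0.
have [_ [_ u0] _ _ _] := (perron_pairP pinfty_neq_ninfty).2.
by rewrite /stationary /left_vec u0 // !mul0r.
Qed.

Lemma KL_real_ge0 (r theta : R) : 0 <= KL P f r%:E theta.
Proof.
apply: divergence_ge0.
- exact: stationary_ge0.
- exact: exp_family_ge0.
- exact: exp_family_ge0.
- exact: exp_family_sum.
- exact: exp_family_sum.
- by move=> x y; exact: exp_family_ac.
Qed.

Lemma KL_divergence t (theta : R) :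
  KL P f t theta =
  divergence (stationary P f t) (exp_family P f t) (exp_family P f theta%:E).
Proof. by []. Qed.

Local Opaque mean KL stationary exp_family.

(** The logarithms of the spectral radii cancel. This identity carries both
    the monotonicity and the continuity of the mean. *)
Lemma KL_real_symmetric_sum (r theta : R) :
  KL P f r%:E theta + KL P f theta%:E r =
  (r - theta) * (mean P f r%:E - mean P f theta%:E).
Proof.
rewrite (KL_real r theta) (KL_real theta r).
have cancel (a b c d : R) :
    (r - theta) * a - (c - d) + ((theta - r) * b - (d - c)) = (r - theta) * (a - b).
  by ring.
exact: cancel.
Qed.


(** If two members of the family coincide, then exp((r - theta) f(y)) g(y) =
    lambda g(x) along every edge. Inside the maximizers of f this forces
    exp((r - theta) * max f) = lambda, inside the minimizers
    exp((r - theta) * min f) = lambda. *)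
Lemma exp_family_inj (r theta : R) :
  (forall x y, exp_family P f r%:E x y = exp_family P f theta%:E x y) ->
  r = theta.
Proof.
move=> eqP12; have [x0 _] := state_exists.
pose g x := right_vec P f r%:E x / right_vec P f theta%:E x.
have g_gt0 x : 0 < g x by rewrite divr_gt0 // right_vec_gt0.
pose lambda := expR (- ((r - theta) * 0)) * (rho P f r%:E / rho P f theta%:E).
have lambda_gt0 : 0 < lambda by rewrite mulr_gt0 ?expR_gt0 // divr_gt0 // rho_gt0.
have cocycle x y : 0 < P x y -> expR ((r - theta) * (f y - 0)) * g y = lambda * g x.
  rewrite -(exp_family_edge theta) => Pxy.
  have lg_neq0 : lambda * g x != 0 by rewrite gt_eqF // mulr_gt0.
  apply: (mulfI (lt0r_neq0 Pxy)); apply: (mulIf (invr_neq0 lg_neq0)).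
  rewrite mulfK // mulrA -[RHS]eqP12.
  exact/esym/exp_family_tilt_real.
have rate (K : {set S}) (c : R) (x1 : S) : x1 \in K ->
    (forall x, x \in K -> f x = c) ->
    (forall x, exists y, 0 < P x y /\ y \in K) ->
    expR ((r - theta) * (c - 0)) = lambda.
  move=> x1K fK edge.
  apply: (closed_class_growth_rate x1K (expR_gt0 _) g_gt0) => x xK.
  by have [y [Pxy yK]] := edge x; exists y => //; rewrite -(fK y yK); exact: cocycle.
have [xM xMK _] := fmax_attained f x0; have [xm xmK _] := fmin_attained f x0.
have := rate _ _ _ xMK (@Smax_eq _ _ f) (core_edge Smax_irreducible reach_Smax).
rewrite -(rate _ _ _ xmK (@Smin_eq _ _ f) (core_edge Smin_irreducible reach_Smin)).
move=> /expR_inj; rewrite !subr0 => /eqP; rewrite -subr_eq0 -mulrBr mulf_eq0.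
rewrite [fmax f - _ == 0]subr_eq0 (gt_eqF (fmin_lt_fmax f_nonconstant)) orbF subr_eq0.
by move/eqP.
Qed.

(** If the mean did not increase, the symmetric sum of the two divergences
    would be nonpositive, so a divergence would vanish. *)
Lemma mean_lt (r theta : R) : r < theta -> mean P f r%:E < mean P f theta%:E.
Proof.
move=> r_lt; have sum := KL_real_symmetric_sum theta r.
have [KL1 KL2] := (KL_real_ge0 theta r, KL_real_ge0 r theta).
rewrite ltNge; apply/negP => mean_le.
have h_gt0 : 0 < theta - r by rewrite subr_gt0.
have d_le0 : mean P f theta%:E - mean P f r%:E <= 0 by rewrite subr_le0.
have KL0 := nonneg_pair_vanish KL1 KL2 h_gt0 d_le0 sum.
rewrite KL_divergence in KL0.
have := @exp_family_inj r theta; rewrite (_ : r = theta <-> False); last first.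
  by split=> // rt; rewrite rt ltxx in r_lt.
apply; apply: (@divergence_eq0 R S (stationary P f r%:E) _ _ _ _ _ _ _ _ _ KL0).
- exact: stationary_ge0.
- exact: exp_family_ge0.
- exact: exp_family_ge0.
- exact: exp_family_sum.
- exact: exp_family_sum.
- by move=> x y; exact: exp_family_ac.
- exact: stationary_gt0.
Qed.

(** Both divergences between the parameters theta and r are at most
    (2 C |r - theta|)^2 when r is close to theta, and their sum is
    |r - theta| times the absolute increment of the mean. *)
Lemma mean_locally_lipschitz (theta : R) : exists2 C : R, 0 < C &
  forall r, C * `|r - theta| <= 2^-1 ->
    `|mean P f r%:E - mean P f theta%:E| <= 8 * C ^+ 2 * `|r - theta|.
Proof.
have [x0 _] := state_exists.
have [xF _ F_max] := maximizer (fun x => `|f x|) (finset.in_setT x0).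
have {}F_max x : `|f x| <= `|f xF| by exact: F_max.
have [delta [delta_gt0 _ Q_delta]] := edge_lower_bound (exp_family P f theta%:E).
(* The summand 1 only makes C positive. *)
pose C := (1 + (delta^-1 + 1) ^+ #|S|) * (2 * `|f xF|) + 1.
have C_ge0 : 0 <= (1 + (delta^-1 + 1) ^+ #|S|) * (2 * `|f xF|).
  by rewrite mulr_ge0 ?mulr_ge0 // addr_ge0 // exprn_ge0 // addr_ge0 // invr_ge0 ltW.
exists C; first by rewrite ltr_wpDl.
move=> r Cr; pose g x := right_vec P f r%:E x / right_vec P f theta%:E x.
have g_gt0 x : 0 < g x by rewrite divr_gt0 // right_vec_gt0.
pose lambda := expR (- ((r - theta) * 0)) * (rho P f r%:E / rho P f theta%:E).
have lambda_gt0 : 0 < lambda by rewrite mulr_gt0 ?expR_gt0 // divr_gt0 // rho_gt0.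
pose phi y := expR ((r - theta) * (f y - 0)).
have tilt x y : exp_family P f r%:E x y =
    exp_family P f theta%:E x y * phi y * g y / (lambda * g x).
  exact: exp_family_tilt_real.
have Q_connect x y : connect (positive_edge (exp_family P f theta%:E)) x y.
  apply: connect_sub (irreducible_connect x y P_irreducible) => a b Pab.
  by apply: connect1; rewrite /positive_edge exp_family_edge.
have g_eigen x : \sum_y exp_family P f theta%:E x y * expR ((r - theta) * f y) * g y =
    lambda * g x.
  rewrite -(tilt_eigen (exp_family_sum (real_neq_ninfty r)) g_gt0 lambda_gt0 tilt x).
  by apply: eq_bigr => y _; rewrite /phi subr0.
have density := tilt_density_bounds (exp_family_ge0 (real_neq_ninfty theta))
  (exp_family_sum (real_neq_ninfty theta)) Q_connect delta_gt0 Q_delta F_max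
  g_gt0 g_eigen.
(* Each of the two densities is at least b. *)
pose b := 1 - C * `|r - theta|.
have b_ge : 2^-1 <= b by rewrite /b; lra.
have b_gt0 : 0 < b by apply: lt_le_trans b_ge; rewrite invr_gt0.
have b_le1 : b <= 1 by rewrite /b gerBl mulr_ge0 // ltW // ltr_wpDl.
have b_le : b <= 1 - (1 + (delta^-1 + 1) ^+ #|S|) * (2 * (`|r - theta| * `|f xF|)).
  rewrite /b lerD2l lerN2 /C.
  apply: (@le_trans _ _ ((1 + (delta^-1 + 1) ^+ #|S|) * (2 * (`|r - theta| * `|f xF|))
    + `|r - theta|)); first by rewrite lerDl.
  by rewrite le_eqVlt; apply/orP; left; apply/eqP; ring.
have ratio x y : b * exp_family P f theta%:E x y <= exp_family P f r%:E x y /\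
    b * exp_family P f r%:E x y <= exp_family P f theta%:E x y.
  have Q_ge0 := exp_family_ge0 (real_neq_ninfty theta) x y.
  have [lower upper] := density x y.
  have lg_gt0 : 0 < lambda * g x by rewrite mulr_gt0.
  rewrite tilt /phi subr0 -[_ * _ * g y]mulrA.
  have z_gt0 : 0 < expR ((r - theta) * f y) * g y by rewrite mulr_gt0 ?expR_gt0.
  apply: density_ratio_bounds => //.
    by apply: le_trans lower; rewrite ler_pM2r.
  by apply: le_trans upper; rewrite ler_pM2r.
have KL_le t t' : (t = r /\ t' = theta) \/ (t = theta /\ t' = r) ->
    KL P f t%:E t' <= (2 * (1 - b)) ^+ 2.
  move=> tt'; rewrite KL_divergence; apply: divergence_le.
  - exact: stationary_ge0.
  - exact: exp_family_ge0.
  - exact: exp_family_ge0.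
  - exact: exp_family_sum.
  - exact: exp_family_sum.
  - exact: stationary_sum.
  - move=> x y; have [lower upper] := ratio x y.
    have [r_ge0 theta_ge0] := (exp_family_ge0 (real_neq_ninfty r) x y,
      exp_family_ge0 (real_neq_ninfty theta) x y).
    case: tt' => -[-> ->].
      exact: (close_of_ratio_bounds r_ge0 theta_ge0 b_ge b_le1 lower upper).
    exact: (close_of_ratio_bounds theta_ge0 r_ge0 b_ge b_le1 upper lower).
have sum_le : (r - theta) * (mean P f r%:E - mean P f theta%:E) <=
    8 * C ^+ 2 * `|r - theta| * `|r - theta|.
  rewrite -KL_real_symmetric_sum.
  apply: le_trans (lerD (KL_le _ _ (or_introl (conj erefl erefl)))
    (KL_le _ _ (or_intror (conj erefl erefl)))) _.
  by rewrite /b le_eqVlt; apply/orP; left; apply/eqP; ring.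
have sum_ge0 : 0 <= (r - theta) * (mean P f r%:E - mean P f theta%:E).
  by rewrite -KL_real_symmetric_sum addr_ge0 // KL_real_ge0.
have [rt0|rt_neq0] := eqVneq (r - theta) 0.
  move/eqP: rt0; rewrite subr_eq0 => /eqP->.
  by rewrite subrr normr0 mulr_ge0 // mulr_ge0 // sqr_ge0.
have h_gt0 : 0 < `|r - theta| by rewrite normr_gt0.
rewrite -(ler_pM2r h_gt0); apply: le_trans sum_le.
by rewrite mulrC -normrM ger0_norm.
Qed.


Lemma mean_continuous : continuous (fun r : R => mean P f r%:E).
Proof.
move=> theta; have [C C_gt0 lip] := mean_locally_lipschitz theta.
apply/cvgrPdist_le => e e_gt0; apply/nbhs_ballP.
pose L := 8 * C ^+ 2 + 2 * C.
have L_gt0 : 0 < L by rewrite addr_gt0 // mulr_gt0 // exprn_gt0.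
exists (Num.min 1 e / L); first by rewrite /= divr_gt0 // lt_min ltr01.
move=> r; rewrite /ball /= distrC ltr_pdivlMr // => /ltW.
rewrite le_min => /andP[close1 close_e].
have h_ge0 : 0 <= `|r - theta| by [].
rewrite distrC; apply: (le_trans (lip r _)).
  move: close1; rewrite /L; have := ltW C_gt0; have := sqr_ge0 C.
  by move: `|r - theta| h_ge0 => h h_ge0; nra.
apply: le_trans close_e; rewrite mulrC ler_wpM2l // /L lerDl.
by rewrite mulr_ge0 // ltW.
Qed.

(** At a minimizer of the right eigenvector over the maximizers of f, one
    term of the eigenvector equation suffices. *)
Lemma rho_lower_bound : exists2 delta : R, 0 < delta &
  forall r, delta * expR (r * fmax f) <= rho P f r%:E.
Proof.
have [x0 _] := state_exists; have [delta [delta_gt0 _ P_delta]] := edge_lower_bound P.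
exists delta => // r; have [xM xMK _] := fmax_attained f x0.
have [x xK x_min] := minimizer (right_vec P f r%:E) xMK.
have [y [Pxy yK]] := core_edge Smax_irreducible reach_Smax x.
have v_gt0 := right_vec_gt0 (real_neq_ninfty r).
rewrite -(ler_pM2r (v_gt0 x)) -(right_vec_eigen (real_neq_ninfty r)).
rewrite (bigD1 y) //= (Smax_eq yK).
apply: (@le_trans _ _ (P x y * expR (r * fmax f) * right_vec P f r%:E y)).
  apply: ler_pM; rewrite ?x_min //.
  - by rewrite mulr_ge0 ?expR_ge0 // ltW.
  - by rewrite ltW.
  - by rewrite ler_pM2r ?expR_gt0 // P_delta.
rewrite lerDl; apply: sumr_ge0 => z _.
by rewrite !mulr_ge0 ?expR_ge0 // ltW.
Qed.

(** Nonnegativity of the divergence from parameter 0 reads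
    r * mean r >= ln (rho r) - ln (rho 0), and ln (rho r) >= r * max f + ln delta. *)
Lemma mean_approaches_fmax (mu : R) : mu < fmax f ->
  exists r : R, mu <= mean P f r%:E.
Proof.
move=> mu_lt; have [delta delta_gt0 rho_ge] := rho_lower_bound.
pose B := ln (rho P f 0%:E) - ln delta.
have gap_gt0 : 0 < fmax f - mu by rewrite subr_gt0.
pose r := (`|B| + 1) / (fmax f - mu).
have r_gt0 : 0 < r by rewrite divr_gt0 // ltr_wpDl.
exists r; have := KL_real_ge0 r 0; rewrite KL_real subr0.
have ln_rho : ln delta + r * fmax f <= ln (rho P f r%:E).
  rewrite -[r * _]expRK -lnM ?posrE ?expR_gt0 // ler_ln ?posrE ?rho_gt0 //.
  by rewrite mulr_gt0 ?expR_gt0.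
have rgap : r * (fmax f - mu) = `|B| + 1 by rewrite divfK // gt_eqF.
have B_le : B <= `|B| by exact: ler_norm.
have arith (a k0 k1 d M c : R) : k0 - d <= c -> r * (M - mu) = c + 1 ->
    d + r * M <= k1 -> 0 <= r * a - (k1 - k0) -> mu <= a.
  move=> h1 h2 h3 h4; rewrite -(ler_pM2l r_gt0); lra.
exact: arith B_le rgap ln_rho.
Qed.

Lemma mean_inj (t : \bar R) (r : R) : mean P f t = mean P f r%:E -> t = r%:E.
Proof.
case: t => [s||] eq_mean.
- congr EFin; apply/eqP; rewrite eq_le; apply/andP; split; rewrite leNgt;
  by apply/negP => /mean_lt; rewrite eq_mean ltxx.
- by have := mean_lt_fmax r; rewrite -eq_mean ltxx.
- by have := fmin_lt_mean r; rewrite -eq_mean ltxx.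
Qed.

Lemma param_mean (r : R) : param P f (mean P f r%:E) = r%:E.
Proof.
apply: mean_inj.
exact: (@xgetPex _ 0%E (fun t => mean P f t = mean P f r%:E) (ex_intro _ r%:E erefl)).
Qed.

Lemma param_fmax : param P f (fmax f) = +oo%E.
Proof.
have := @xgetPex _ 0%E (fun t => mean P f t = fmax f) (ex_intro _ +oo%E erefl).
rewrite -/(param P f (fmax f)); case: (param P f (fmax f)) => [r|//|].
  by move=> eq_mean; have := mean_lt_fmax r; rewrite eq_mean ltxx.
by move=> eq_mean; have := fmin_lt_fmax f_nonconstant; rewrite -eq_mean ltxx.
Qed.

Lemma mean_surjective (theta mu : R) : mean P f theta%:E <= mu -> mu < fmax f ->
  exists2 r : R, theta <= r & mean P f r%:E = mu.
Proof.
move=> theta_mu /mean_approaches_fmax[s mu_s].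
have theta_s : theta <= s.
  rewrite leNgt; apply/negP => /mean_lt s_theta.
  by have := le_lt_trans (le_trans theta_mu mu_s) s_theta; rewrite ltxx.
have between (a b v : R) : a <= v -> v <= b -> Num.min a b <= v <= Num.max a b.
  by move=> av vb; rewrite ge_min av le_max vb orbT.
have [||r] := @IVT R (fun r => mean P f r%:E) theta s mu theta_s.
- exact: continuous_subspaceT mean_continuous.
- exact: between theta_mu mu_s.
- by rewrite in_itv => /andP[theta_r _] mean_r; exists r.
Qed.


Lemma KL_mean_param (mu1 mu2 : R) t (theta : R) :
  param P f mu1 = t -> param P f mu2 = theta%:E -> KL_mean P f mu1 mu2 = KL P f t theta.
Proof. by rewrite /KL_mean => -> ->. Qed.

Section ChernoffFromRatioBound.
Variable C : R.
Hypothesis right_vec_ratio : forall t x y, t != -oo%E ->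
  right_vec P f t x <= C * right_vec P f t y.

Variables (theta : R) (d : measure_display) (Omega : measurableType d).
Variables (Pr : probability Omega R) (X : nat -> Omega -> S) (n : nat).
Hypothesis X_markov : markov_chain Pr X (exp_family P f theta%:E).

(** The quotient of two eigenvectors whose ratios are at most C has ratios at
    most C ^+ 2. *)
Lemma change_of_measure_bound (t : \bar R) (phi : S -> R) (lambda mu : R) :
  t != -oo%E -> 0 < lambda -> (forall y, 0 <= phi y) ->
  (forall x y, exp_family P f t x y = exp_family P f theta%:E x y * phi y *
    (right_vec P f t y / right_vec P f theta%:E y) /
    (lambda * (right_vec P f t x / right_vec P f theta%:E x))) ->
  (forall w, n%:R * mu <= \sum_(1 <= i < n.+1) f (X i w) ->
    1 <= \prod_(1 <= i < n.+1) phi (X i w)) ->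
  (Pr [set w | (n%:R * mu <= \sum_(1 <= i < n.+1) f (X i w))%R]%classic <=
    (C ^+ 2 * expR (- (n%:R * - ln lambda)))%:E)%E.
Proof.
move=> t_neq lambda_gt0 phi_ge0 tilt weight; have [x0 _] := state_exists.
rewrite mulrN opprK expRM_natl lnK ?posrE //.
pose g x := right_vec P f t x / right_vec P f theta%:E x.
have vt_gt0 := right_vec_gt0 t_neq.
have v_gt0 := right_vec_gt0 (real_neq_ninfty theta).
have g_gt0 x : 0 < g x by rewrite divr_gt0.
apply: (markov_chain_exponential_bound X_markov phi_ge0 g_gt0) => //.
- exact: exp_family_ge0.
- exact: (tilt_eigen (exp_family_sum t_neq) g_gt0 lambda_gt0 tilt).
- exact: measurable_sum_event X_markov _ _ _.
- move=> x y; rewrite /g mulrA ler_pdivlMr // mulrAC ler_pdivrMr //.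
  have -> : C ^+ 2 * right_vec P f t y * right_vec P f theta%:E x =
      (C * right_vec P f t y) * (C * right_vec P f theta%:E x).
    have comm (a b : R) : C ^+ 2 * a * b = C * a * (C * b) by ring.
    exact: comm.
  by apply: ler_pM; rewrite ?(ltW (vt_gt0 _)) ?(ltW (v_gt0 _)) ?right_vec_ratio.
Qed.

Lemma chernoff_real (r mu : R) : theta <= r -> mean P f r%:E = mu ->
  (Pr [set w | (n%:R * mu <= \sum_(1 <= i < n.+1) f (X i w))%R]%classic <=
    (C ^+ 2 * expR (- (n%:R * KL P f r%:E theta)))%:E)%E.
Proof.
move=> theta_r mean_r.
have ratio_gt0 : 0 < rho P f r%:E / rho P f theta%:E by rewrite divr_gt0 // rho_gt0.
pose lambda := expR (- ((r - theta) * mu)) * (rho P f r%:E / rho P f theta%:E).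
have lambda_gt0 : 0 < lambda by rewrite mulr_gt0 // expR_gt0.
have -> : KL P f r%:E theta = - ln lambda.
  rewrite KL_real /lambda mean_r lnM ?posrE ?expR_gt0 //.
  by rewrite expRK ln_div ?posrE ?rho_gt0 // [RHS]opprD opprK.
apply: (@change_of_measure_bound r%:E (fun y => expR ((r - theta) * (f y - mu)))) => //.
  by move=> x y; exact: exp_family_tilt_real.
move=> w sum_ge; rewrite -expR_sum -[leLHS]expR0 ler_expR -mulr_sumr.
rewrite mulr_ge0 ?subr_ge0 // sumrB subr_ge0; apply: le_trans sum_ge.
by rewrite sumr_const_nat subn1 -[leLHS]mulr_natl /=.
Qed.

Lemma chernoff_pinfty :
  (Pr [set w | (n%:R * fmax f <= \sum_(1 <= i < n.+1) f (X i w))%R]%classic <=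
    (C ^+ 2 * expR (- (n%:R * KL P f +oo%E theta)))%:E)%E.
Proof.
rewrite KL_pinfty.
apply: (@change_of_measure_bound +oo%E (fun y => (y \in Smax f)%:R)) => //.
- by rewrite mulr_gt0 ?expR_gt0 // divr_gt0 // rho_gt0.
- by move=> x y; exact: exp_family_tilt_pinfty.
move=> w sum_ge.
have sum0 : \sum_(1 <= i < n.+1) (fmax f - f (X i w)) <= 0.
  by rewrite sumrB sumr_const_nat subn1 /= -mulr_natl subr_le0.
rewrite big_nat big1 // => i i_n.
have : f (X i w) == fmax f.
  rewrite eq_le le_fmax -subr_le0 /=; apply: le_trans sum0.
  rewrite (bigD1_seq i) ?mem_index_iota ?iota_uniq //= lerDl.
  by apply: sumr_ge0 => j _; rewrite subr_ge0 le_fmax.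
by rewrite inE => ->.
Qed.

End ChernoffFromRatioBound.

Lemma chernoff_of_ratio_bound (C : R) :
  (forall t x y, t != -oo%E -> right_vec P f t x <= C * right_vec P f t y) ->
  chernoff_bound P f C.
Proof.
move=> ratio theta d Omega Pr X n mu X_markov _ /andP[mean_le].
rewrite le_eqVlt => /predU1P[->|mu_lt].
  rewrite (KL_mean_param param_fmax (param_mean theta)); exact: chernoff_pinfty.
have [r theta_r mean_r] := mean_surjective mean_le mu_lt.
have param_mu : param P f mu = r%:E by rewrite -mean_r; exact: param_mean.
rewrite (KL_mean_param param_mu (param_mean theta)); exact: chernoff_real.
Qed.

(** In rho * v(x) and rho * v(y) the same nonnegative weights multiply
    P(x, z) and P(y, z). *)
Lemma right_vec_ratio_positive : (forall x y, 0 < P x y) ->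
  forall t x y, t != -oo%E -> right_vec P f t x <= max_ratio P * right_vec P f t y.
Proof.
move=> P_gt0 t x y t_neq.
have ratio_le z : P x z <= max_ratio P * P y z.
  rewrite -ler_pdivrMr // /max_ratio; apply: (bigmax_sup y) => //.
  by apply: (bigmax_sup x) => //; exact: (bigmax_sup z).
have v_gt0 := right_vec_gt0 t_neq.
rewrite -(ler_pM2l (rho_gt0 t_neq)) mulrCA -!right_vec_eigen // mulr_sumr.
apply: ler_sum => z _; rewrite mulrA ler_pM2r //.
case: t t_neq {v_gt0} => [r||] //= _; rewrite mulrA.
  by rewrite ler_pM2r ?expR_gt0.
by rewrite ler_wpM2r.
Qed.

(** Here s normalizes the tilt so that its weight is 1 on K. *)
Lemma right_vec_ratio_core (K : {set S}) (delta s : R) (w : S -> R) t x y :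
  t != -oo%E -> 0 < s ->
  (forall a b, tilted P f t a b = s * (P a b * w b)) ->
  irreducible (@submatrix R S P K) ->
  (forall x, x \notin K -> exists y, y \in K /\ 0 < P x y) ->
  0 < delta -> delta <= 1 -> (forall x y, 0 < P x y -> delta <= P x y) ->
  (forall y, 0 <= w y) -> (forall y, w y <= 1) ->
  (forall y, y \in K -> w y = 1) -> (forall y, y \notin K -> w y <= delta / 2) ->
  right_vec P f t x <= 2 / delta * delta^-1 ^+ #|S| * right_vec P f t y.
Proof.
move=> t_neq s_gt0 tiltedE K_irr K_reach delta_gt0 delta_le1 P_delta w0 w1 wK wC.
have eigen a : \sum_b P a b * w b * right_vec P f t b =
    rho P f t / s * right_vec P f t a.
  apply: (mulfI (lt0r_neq0 s_gt0)).
  rewrite [RHS]mulrA [s * (_ / _)]mulrC divfK ?gt_eqF //.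
  rewrite -right_vec_eigen // mulr_sumr; apply: eq_bigr => b _.
  by rewrite tiltedE -!mulrA.
apply: (dominant_core_ratio P_ge0 P_stochastic.2 (core_edge K_irr K_reach)
  (core_connect K_irr K_reach) delta_gt0 delta_le1 P_delta w0 w1 wK wC
  (right_vec_gt0 t_neq) eigen).
Qed.

Lemma right_vec_ratio_bounded_temperature (T : R) : exists2 C : R, 0 <= C &
  forall r x y, `|r| <= T -> right_vec P f r%:E x <= C * right_vec P f r%:E y.
Proof.
have [x0 _] := state_exists.
have [xF _ F_max] := maximizer (fun x => `|f x|) (finset.in_setT x0).
have {}F_max x : `|f x| <= `|f xF| by exact: F_max.
have [delta [delta_gt0 delta_le1 P_delta]] := edge_lower_bound P.
pose B := expR (`|T| * `|f xF|).
have B_ge1 : 1 <= B by rewrite -expR0 ler_expR mulr_ge0.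
have B_gt0 : 0 < B by exact: lt_le_trans B_ge1.
pose e := delta / B / B.
have e_gt0 : 0 < e by rewrite !divr_gt0.
exists (e^-1 ^+ #|S|); first by rewrite exprn_ge0 // invr_ge0 ltW.
move=> r x y rT.
have rf_le z : `|r * f z| <= `|T| * `|f xF|.
  by rewrite normrM ler_pM // (le_trans rT) // ler_norm.
have tilt_le z : expR (r * f z) <= B.
  by rewrite ler_expR (le_trans (ler_norm _)).
have tilt_ge z : B^-1 <= expR (r * f z).
  by rewrite -expRN ler_expR lerNl (le_trans (ler_norm _)) // normrN.
have r_neq := real_neq_ninfty r.
have v_gt0 := right_vec_gt0 r_neq.
have rho_le : rho P f r%:E <= B.
  have [z _ z_max] := maximizer (right_vec P f r%:E) (finset.in_setT x0).
  rewrite -(ler_pM2r (v_gt0 z)) -right_vec_eigen //.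
  apply: (@le_trans _ _ (\sum_a P z a * (B * right_vec P f r%:E z))); last first.
    by rewrite -mulr_suml P_stochastic.2 mul1r.
  apply: ler_sum => a _; rewrite -mulrA ler_wpM2l //.
  by apply: ler_pM; rewrite ?expR_ge0 ?tilt_le ?z_max ?ltW.
apply: (connected_eigenvector_ratio (tilted_ge0 r%:E) _ v_gt0 (rho_gt0 r_neq)
  (right_vec_eigen r_neq) e_gt0) => [a b||a b].
- apply: connect_sub (irreducible_connect a b P_irreducible) => a' b' Pab.
  by apply: connect1; rewrite /positive_edge tilted_edge_real.
- by rewrite /e ler_pdivrMr // ler_pdivrMr // mul1r (le_trans delta_le1) // mulr_ege1.
- rewrite tilted_edge_real => /P_delta Pab.
  apply: (@le_trans _ _ (delta * B^-1)).
    have dB_ge0 : 0 <= delta / B by apply: divr_ge0; exact: ltW.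
    by rewrite /e -mulrA ler_piMr // ler_pdivrMl // mulr1.
  apply: ler_pM => //; [exact: ltW | by rewrite invr_ge0 ltW].
Qed.

Lemma right_vec_ratio_uniform : exists C : R,
  forall t x y, t != -oo%E -> right_vec P f t x <= C * right_vec P f t y.
Proof.
have [delta [delta_gt0 delta_le1 P_delta]] := edge_lower_bound P.
have half_gt0 : 0 < delta / 2 by rewrite divr_gt0.
have gap_max y : y \notin Smax f -> 0 < fmax f - f y.
  by rewrite inE => fy; rewrite subr_gt0 lt_neqAle fy le_fmax.
have gap_min y : y \notin Smin f -> 0 < f y - fmin f.
  by rewrite inE eq_sym => fy; rewrite subr_gt0 lt_neqAle fy ge_fmin.
have [T1 T1_ge0 decay_max] := uniform_decay half_gt0 gap_max.
have [T2 T2_ge0 decay_min] := uniform_decay half_gt0 gap_min.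
have [C C_ge0 bounded] := right_vec_ratio_bounded_temperature (T1 + T2).
pose C' := 2 / delta * delta^-1 ^+ #|S|.
have C'_ge0 : 0 <= C' by rewrite mulr_ge0 ?exprn_ge0 ?divr_ge0 ?invr_ge0 ?ltW.
exists (C + C') => t x y t_neq.
have v_ge0 : 0 <= right_vec P f t y by exact: ltW (right_vec_gt0 t_neq y).
suff [le_C|le_C'] : right_vec P f t x <= C * right_vec P f t y \/
    right_vec P f t x <= C' * right_vec P f t y.
- by apply: le_trans le_C _; rewrite ler_wpM2r // lerDl.
- by apply: le_trans le_C' _; rewrite ler_wpM2r // lerDr.
case: t t_neq {v_ge0} => [r||//] t_neq; last first.
  right; apply: (right_vec_ratio_core (K := Smax f) (s := 1)
    (w := fun y => (y \in Smax f)%:R)) => //.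
  - by move=> a b; rewrite mul1r.
  - by move=> z; rewrite lern1 leq_b1.
  - by move=> z ->.
  - by move=> z /negPf->; exact: ltW.
have [r_big|r_small] := lerP T1 r.
  right; apply: (right_vec_ratio_core (K := Smax f) (s := expR (r * fmax f))
    (w := fun y => expR (- (r * (fmax f - f y))))) => //.
  - exact: expR_gt0.
  - by move=> a b /=; rewrite mulrCA -expRD; congr (_ * expR _); ring.
  - move=> z; rewrite -expR0 ler_expR oppr_le0.
    by rewrite mulr_ge0 ?subr_ge0 ?le_fmax // (le_trans T1_ge0).
  - by move=> z /Smax_eq->; rewrite subrr mulr0 oppr0 expR0.
  - by move=> z; exact: decay_max.
have [r_big'|r_small'] := lerP T2 (- r).
  right; apply: (right_vec_ratio_core (K := Smin f) (s := expR (r * fmin f))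
    (w := fun y => expR (- (- r * (f y - fmin f))))) => //.
  - exact: expR_gt0.
  - by move=> a b /=; rewrite mulrCA -expRD; congr (_ * expR _); ring.
  - move=> z; rewrite -expR0 ler_expR oppr_le0.
    by rewrite mulr_ge0 ?subr_ge0 ?ge_fmin // (le_trans T2_ge0).
  - by move=> z /Smin_eq->; rewrite subrr mulr0 oppr0 expR0.
  - by move=> z; exact: decay_min.
left; apply: bounded; rewrite ler_norml; apply/andP; split.
  by rewrite lerNl (le_trans (ltW r_small')) // lerDr.
by rewrite (le_trans (ltW r_small)) // lerDl.
Qed.

End ExponentialFamily.

(** * The Chernoff bound *)

Theorem theorem2 (R : realType) (S : finType) (P : S -> S -> R) (f : S -> R)
  (f_nonconstant : exists x y, f x <> f y)
  (P_irreducible : irreducible P)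
  (P_stochastic : stochastic P)
  (Smax_irreducible : irreducible (@submatrix R S P (Smax f)))
  (Smin_irreducible : irreducible (@submatrix R S P (Smin f)))
  (reach_Smax : forall x, x \notin Smax f -> exists y, y \in Smax f /\ 0 < P x y)
  (reach_Smin : forall x, x \notin Smin f -> exists y, y \in Smin f /\ 0 < P x y) :
  (exists C : R, chernoff_bound P f C) /\
  ((forall x y, 0 < P x y) -> chernoff_bound P f (max_ratio P)).
Proof.
split=> [|P_gt0].
  have [C ratio] := right_vec_ratio_uniform f_nonconstant P_irreducible
    P_stochastic Smax_irreducible Smin_irreducible reach_Smax reach_Smin.
  by exists C; apply: chernoff_of_ratio_bound.
by apply: chernoff_of_ratio_bound => //; exact: right_vec_ratio_positive.
Qed.
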